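(* Let $n\ge 1$ and $l\ge 0$ be integers. Consider the set of real polynomials $f(x)=x^{N}+\lambda_2x^{N-2}+\cdots+\lambda_{N-1}x$ of degree $N=2l+n$ all of whose critical points are real, such that $f'$ has exactly $l$ double roots and $n-1$ simple roots, and the values of $f$ at distinct critical points are distinct (the open strata of the caustic of the singularity $A_{2l+n-1}$ corresponding to polynomials of the M-domain with $l$ double critical points and distinct critical values at distinct critical points). The number of connected components of this set is $K_n^l/l!$.
   Context: For an integer $n\ge 1$ let $P_n$ be the space of real polynomials of the form $x^n+\lambda_2x^{n-2}+\cdots+\lambda_{n-1}x$, with the topology of the coefficients $\lambda_i\in\mathbb R$ (so $P_1=\{x\}$, $P_2=\{x^2\}$). The M-domain is the closed subset of $P_n$ consisting of polynomials all of whose critical points are real. For $l\ge 0$ consider pairs $(f;b_1,\dots,b_l)\in P_n\times\mathbb R^l$; the $b_i$ are the (labelled) boundary points and the numbers $f(b_i)$ are the boundary values. Such a pair is a very nice M-morsification of $B_n^l$ if all $n-1$ critical points of $f$ (counted with multiplicity) are real and the $n-1$ critical values together with the $l$ boundary values are all pairwise distinct. $K_n^l$ is the number of connected components of the set of very nice M-morsifications of $B_n^l$, as a subspace of $P_n\times\mathbb R^l$. *)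

(* Defs.v *)
From mathcomp Require Import all_boot all_order all_algebra.
From mathcomp Require Import finmap.
From mathcomp Require Import all_classical all_reals topology normedtype.
From mathcomp Require Import complex.

Set Implicit Arguments.
Unset Strict Implicit.
Unset Printing Implicit Defensive.

Import Order.TTheory GRing.Theory Num.Theory.
Import numFieldNormedType.Exports.

Local Open Scope classical_set_scope.
Local Open Scope card_scope.
Local Open Scope ring_scope.

Definition components (T : topologicalType) (A : set T) : set (set T) :=
  connected_component A @` A.

(* Only meaningful when [components A] is finite: [fset_set] sends an infinite
   set to the empty finite set. *)
Definition nb_components (T : topologicalType) (A : set T) : nat :=
  #|` fset_set (components A)|.

(* P_n is identified with its coefficient space R^(n-2), with the topology of
   R^(n-2): the entry of index i (starting at 0) is lambda_{i+2}, the
   coefficient of x^(n-2-i). For n = 1, 2 the space is the single point R^0,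
   truncated subtraction giving the right dimension in both cases. *)
Definition Pspace (R : realType) (n : nat) := 'rV[R]_(n - 2).

Definition Ppoly (R : realType) (n : nat) (a : Pspace R n) : {poly R} :=
  'X^n + \sum_(i < n - 2) a 0 i *: 'X^(n - 2 - i).

(* Critical points are a priori complex. *)
Definition M_domain (R : realType) (n : nat) : set (Pspace R n) :=
  [set a | forall z : R[i],
     root (map_poly (real_complex R) (Ppoly a)^`()) z -> complex.Im z = 0].

(* [c] lists the n-1 critical points of f, repeated according to multiplicity,
   so a multiple critical point is excluded by the distinctness of the critical
   values. *)
Definition very_nice_M_morsification (R : realType) (n l : nat) :
    set (Pspace R n * 'rV[R]_l) :=
  [set p : Pspace R n * 'rV[R]_l | let f := Ppoly p.1 in
     M_domain p.1 /\
     exists c : seq R,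
       [/\ size c = (n - 1)%N,
           f^`() = n%:R *: \prod_(x <- c) ('X - x%:P)
         & uniq ([seq f.[x] | x <- c] ++ [seq f.[p.2 0 i] | i : 'I_l])]].

Definition K (R : realType) (n l : nat) : nat :=
  nb_components (@very_nice_M_morsification R n l).

Definition caustic_strata (R : realType) (N d s : nat) : set (Pspace R N) :=
  [set a | let f := Ppoly a in
     [/\ M_domain a,
         [set x : R | mup x f^`() = 2%N] #= `I_d,
         [set x : R | mup x f^`() = 1%N] #= `I_s
       & forall x y : R, root f^`() x -> root f^`() y -> x != y ->
           f.[x] != f.[y]]].

(* Main.v *)
(* List the critical and boundary points of a morsification in increasing order,
   c_1 < ... < c_k, and give c_j the multiplicity m_j = 1 if it is critical and
   m_j = 0 if it is a boundary point; then f' is proportional to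
   prod_j (x - c_j)^(m_j). A polynomial of a caustic stratum has the same shape,
   with m_j = 2 at the double and m_j = 1 at the simple critical points. The signs
   of f' on the gaps depend only on the parities of the m_j, so "boundary point"
   and "double critical point" play the same combinatorial role.

   For fixed m, the map F sending the gaps t_i = c_(i+1) - c_i to
   |f(c_(i+1)) - f(c_i)| is a homeomorphism of (0, oo)^(k-1). Infinitesimally it is
   a P-function: if dt_i * dF_i <= 0 for all i, then the rational function
   sum_j m_j dc_j / (x - c_j), normalised by sum_j m_j dc_j = 0, has a zero between
   any two consecutive poles, too many for its numerator, so dt = 0. Being proper
   as well, F can be inverted by eliminating one variable at a time with the
   intermediate value theorem.

   Hence the configurations whose values are in a prescribed order correspond to a
   convex set, which is nonempty exactly when the order is compatible with the
   signs of f'. These pieces are relatively closed, so they are the components.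
   Counting compatible data, the morsifications carry in addition one of the l!
   labellings of the boundary points. *)

Require Import Defs.
From mathcomp Require Import all_boot all_order all_algebra.
From mathcomp Require Import finmap.
From mathcomp Require Import all_classical all_reals topology normedtype.
From mathcomp Require Import derive polyrcf complex ring lra zify.

Set Implicit Arguments.
Unset Strict Implicit.
Unset Printing Implicit Defensive.

Import Order.TTheory GRing.Theory Num.Theory numFieldNormedType.Exports.

Local Open Scope classical_set_scope.
Local Open Scope ring_scope.

(** * Inversion of proper P-functions *)

(** Surjectivity of the gap map would usually come from degree theory or from the inverse function
    theorem with a covering argument. The P-property replaces both: on the coordinate being
    eliminated it becomes monotonicity of a function of one real variable, and continuity of the
    partial inverses follows from properness and injectivity. Passing from the infinitesimal to the
    local property needs uniformity in the direction; for this, differentials are replaced by slopes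
    along chords, continuous up to the diagonal, and the unit sphere is compact. Boundary points
    have multiplicity 0 and are not poles of the rational function, so consecutive poles may have
    boundary points between them, and the case where only boundary points move has to be treated
    apart. Translating a configuration does not change differences of values. When the derivative
    has roots, centring them selects one configuration per translation class, and it amounts to the
    vanishing of the coefficient of x^(N-1). Both spaces are then images of chambers under maps with
    the same abstract properties, so a single decomposition theorem is applied twice. *)

Lemma cvg_row {R : realType} {r : nat} {T : Type} (F : set_system T)
    {FF : Filter F} (f : T -> 'rV[R]_r) (a : 'rV[R]_r) :
  (forall i, (fun x => f x 0 i) @ F --> a 0 i) -> f @ F --> a.
Proof.
move=> fa A [P Pa PA]; rewrite /nbhs/=; apply: filterS (_ : F _).
  by move=> x; exact: (PA (f x)).
apply: filter_forall => i; apply: filter_forall => j.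
by rewrite ord1; apply: fa; rewrite -(ord1 i).
Qed.

Lemma continuous_row {R : realType} {r : nat} {T : topologicalType}
    (f : T -> 'rV[R]_r) :
  (forall i, continuous (fun x => f x 0 i)) -> continuous f.
Proof. by move=> fc x; apply: cvg_row => i; exact: fc. Qed.

Lemma coord_cvg {R : realType} {r : nat} (a : 'rV[R]_r) i :
  (fun x : 'rV[R]_r => x 0 i) @ a --> a 0 i.
Proof. exact: coord_continuous. Qed.

Section elimination.
Variables (R : realType) (r : nat).
Implicit Types (x y t v w : 'rV[R]_r) (E F : 'rV[R]_r -> 'rV[R]_r) (i : 'I_r).

Definition pos_orthant : set 'rV[R]_r := [set t | forall i, 0 < t 0 i].

(** The last two clauses confine the preimages of a box [[b, B]^r] to a box of the same kind. Each
    bounds [t 0 i] through the value of the same index, so they survive replacing some coordinates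
    of [E] by the identity, as [elim_map] does. *)
Definition proper_on_orthant E :=
  [/\ forall i, continuous (fun t => E t 0 i),
      forall t, pos_orthant t -> pos_orthant (E t),
      forall B : R, exists B', forall t, pos_orthant t ->
        forall i, E t 0 i <= B -> t 0 i <= B'
    & forall B b : R, 0 < b -> exists2 b', 0 < b' & forall t, pos_orthant t ->
        (forall j, t 0 j <= B) -> forall i, b <= E t 0 i -> b' <= t 0 i].

(* The nonlinear analogue of a matrix all of whose principal minors are
   positive (a P-matrix). *)
Definition local_P_function E := forall t, pos_orthant t ->
  exists2 N, nbhs t N & forall x y, N x -> N y -> x != y ->
    exists i, 0 < (x 0 i - y 0 i) * (E x 0 i - E y 0 i).

Lemma near_orthant w : pos_orthant w ->
  exists b B : R, 0 < b /\ nbhs w [set v : 'rV[R]_r | forall i, b <= v 0 i <= B].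
Proof.
move=> w0; pose B := 1 + \sum_i w 0 i.
pose b := \big[Num.min/1]_i (w 0 i / 2).
have w_ge0 i : true -> 0 <= w 0 i by move=> _; exact: ltW.
have b0 : 0 < b by rewrite /b; apply: lt_bigmin => // i _; rewrite divr_gt0.
exists b, B; split => //.
apply: (@filter_forall _ _ (fun i (v : 'rV[R]_r) => b <= v 0 i <= B) (nbhs w) _) => i.
have hb : b < w 0 i.
  have : b <= w 0 i / 2 by exact: (@bigmin_le_cond _ _ _ 1 i xpredT (fun i => w 0 i / 2)).
  by move=> /le_lt_trans; apply; rewrite ltr_pdivrMr// mulr2n mulrDr mulr1 ltrDl.
have hB : w 0 i < B.
  by rewrite /B (bigD1 i)//= addrCA ltrDl ltr_wpDr// sumr_ge0// => j _; exact: ltW.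
have h1 : nbhs w [set v : 'rV[R]_r | b < v 0 i] := coord_cvg (lt_nbhsr hb).
have h2 : nbhs w [set v : 'rV[R]_r | v 0 i < B] := coord_cvg (lt_nbhsl hB).
by apply: filterS2 h1 h2 => v /= h1 h2; apply/andP; split; exact: ltW.
Qed.

(** Near [w] all values of [G] lie in one compact box [K]. The part of [K] outside an open
    neighbourhood of [G w] has a closed image, which misses [w] by injectivity; hence [G v] avoids
    that part for [v] near [w]. *)
Lemma right_inverse_continuous E (G : 'rV[R]_r -> 'rV[R]_r) :
  proper_on_orthant E ->
  {in pos_orthant &, injective E} ->
  (forall w, pos_orthant w -> pos_orthant (G w) /\ E (G w) = w) ->
  forall w, pos_orthant w -> G @ w --> G w.
Proof.
move=> [Ec _ Eup Elow] Einj EG w w0.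
have [b [B [b0 nw]]] := near_orthant w0.
have [B' EB'] := Eup B; have [b' b'0 Eb'] := Elow B' b b0.
pose K := [set v : 'rV[R]_r | forall i, `[b', B']%classic (v 0 i)].
have cK : compact K.
  by apply: (@rV_compact _ _ (fun=> `[b', B']%classic)) => _; exact: segment_compact.
have {}Ec : continuous E by exact: continuous_row.
have KG v : (forall i, b <= v 0 i <= B) -> K (G v).
  move=> vb i.
  have v0 : pos_orthant v by move=> j; have /andP[h _] := vb j; exact: (lt_le_trans _ h).
  have [Gv0 EGv] := EG _ v0.
  have GB j : G v 0 j <= B'.
    by apply: EB' => //; rewrite EGv; have /andP[] := vb j.
  rewrite /= in_itv/= GB andbT; apply: Eb' => //; rewrite EGv.
  by have /andP[] := vb i.
move=> N; rewrite nbhsE => -[O [oO OGw] ON].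
pose L := K `&` ~` O.
have cL : compact L.
  by apply: (subclosed_compact _ cK) => [|v []//]; apply: closedI;
    [exact: compact_closed (@norm_hausdorff _ _) cK|exact: open_closedC].
have cEL : closed (E @` L).
  apply: compact_closed; first exact: norm_hausdorff.
  by apply: continuous_compact => //; exact: continuous_subspaceT.
have nELw : ~ (E @` L) w.
  move=> [v [Kv nOv] Evw]; apply: nOv.
  have v0 : pos_orthant v.
    by move=> i; have := Kv i; rewrite /= in_itv/= => /andP[h _]; exact: (lt_le_trans _ h).
  have [Gw0 EGw] := EG _ w0.
  by rewrite (Einj v (G w)) ?inE// Evw EGw.
have := @open_nbhs_nbhs _ w (~` (E @` L)) (conj (closed_openC cEL) nELw).
move=> h; apply: filterS2 nw h => v vb nv; apply: ON.
have Kv := KG v vb; apply: contrapT => nO; apply: nv; exists (G v) => //.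
have v0 : pos_orthant v by move=> j; have /andP[h _] := vb j; exact: (lt_le_trans _ h).
by have [] := EG _ v0.
Qed.

(* A minimum of [g] on [a, b] can only be attained at [a]. *)
Lemma locally_increasing (g : R -> R) (a b : R) : 0 < a -> a < b ->
  (forall s : R, 0 < s -> {for s, continuous g}) ->
  (forall s : R, 0 < s -> \forall z \near s, z < s -> g z < g s) ->
  g a < g b.
Proof.
move=> a0 ab gc gl.
have gw : {within `[a, b], continuous g}.
  apply: continuous_in_subspaceT => x; rewrite inE/= in_itv/= => /andP[ax _].
  by apply: gc; exact: lt_le_trans ax.
have [c /[!in_itv]/= /andP[ac cb] cmin] := EVT_min (ltW ab) gw.
have noint z : a < z -> z <= b -> exists2 y, a <= y <= b & g y < g z.
  move=> az zb; have z0 : 0 < z by exact: lt_trans az.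
  have [e /= e0 ez] := gl _ z0.
  pose y := Num.max a (z - e / 2).
  have yz : y < z by rewrite /y gt_max az/= ltrBlDr ltrDl divr_gt0.
  have ay : a <= y by rewrite le_max lexx.
  exists y; first by rewrite ay ltW// (lt_le_trans yz).
  apply: ez => //=; rewrite ger0_norm ?subr_ge0; last exact: ltW.
  have : z - e / 2 <= y by rewrite /y le_max lexx orbT.
  by move: e0; lra.
have ca : c = a.
  apply/eqP; rewrite eq_le ac andbT leNgt; apply/negP => ac'.
  have [y yab] := noint c ac' cb.
  by rewrite ltNge cmin// in_itv.
have [y yab gyb] := noint b ab (lexx _).
by rewrite -ca; apply: le_lt_trans gyb; apply: cmin; rewrite in_itv.
Qed.

Section step.
Variable F : 'rV[R]_r -> 'rV[R]_r.
Hypotheses (Fproper : proper_on_orthant F) (FP : local_P_function F).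

(** Interpolates from the identity at [p = 0] to [F] at [p = r], so that bijectivity can be proved
    one coordinate at a time. *)
Definition elim_map (p : nat) t : 'rV[R]_r :=
  \row_i (if (i < p)%N then F t 0 i else t 0 i).

Lemma elim_map_proper p : proper_on_orthant (elim_map p).
Proof.
have [Fc F0 Fup Flow] := Fproper; split => [i|t t0 i|B|B b b0].
- rewrite (_ : (fun _ => _) = fun t => if (i < p)%N then F t 0 i else t 0 i).
    by case: (i < p)%N; [exact: Fc|exact: coord_continuous].
  by apply/funext => t; rewrite mxE.
- by rewrite mxE; case: ifP => _; [exact: F0|].
- have [B' HB'] := Fup B; exists (Num.max B B') => t t0 i.
  rewrite mxE; case: ifP => _ h; rewrite le_max ?h// HB' ?orbT//.
- have [b' b'0 Hb'] := Flow B b b0; exists (Num.min b b').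
    by rewrite lt_min b0.
  move=> t t0 tB i; rewrite mxE; case: ifP => _ h; rewrite ge_min ?h//.
  by rewrite Hb' ?orbT.
Qed.

Definition subst_coord w (i0 : 'I_r) (s : R) : 'rV[R]_r :=
  \row_i (if i == i0 then s else w 0 i).

(* Fix all target coordinates but the p-th. By the P-property the p-th value of [F]
   then increases with the p-th coordinate, so it can be prescribed as well. *)
Lemma elim_map_bij p : (p <= r)%N ->
  {in pos_orthant &, injective (elim_map p)} /\
  forall w, pos_orthant w -> exists t, pos_orthant t /\ elim_map p t = w.
Proof.
elim: p => [_|p IHp pr].
  have E0 t : elim_map 0 t = t by apply/rowP => i; rewrite mxE.
  by split=> [x y _ _|w w0]; [rewrite !E0|exists w].
have {IHp} [inj_p surj_p] := IHp (ltnW pr).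
pose i0 := Ordinal pr.
have [G HG] : exists G : 'rV[R]_r -> 'rV[R]_r,
    forall w, pos_orthant w -> pos_orthant (G w) /\ elim_map p (G w) = w.
  have h w : exists t, pos_orthant w -> pos_orthant t /\ elim_map p t = w.
    have [w0|nw0] := pselect (pos_orthant w); last by exists w.
    by have [t ?] := surj_p w w0; exists t.
  by have [G HG] := choice h; exists G.
have Gc := right_inverse_continuous (elim_map_proper p) inj_p HG.
have [Fc F0 Fup Flow] := Fproper.
have sub0 w (s : R) : pos_orthant w -> 0 < s -> pos_orthant (subst_coord w i0 s).
  by move=> w0 s0 i; rewrite mxE; case: ifP.
have Gi0 w (s : R) : pos_orthant w -> 0 < s -> G (subst_coord w i0 s) 0 i0 = s.
  move=> w0 s0; have [_ /rowP/(_ i0)] := HG _ (sub0 _ _ w0 s0).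
  by rewrite !mxE ltnn eqxx.
have Tc w : pos_orthant w -> forall s : R, 0 < s ->
    (fun s => G (subst_coord w i0 s)) @ s --> G (subst_coord w i0 s).
  move=> w0 s s0; apply: continuous_comp (Gc _ (sub0 _ _ w0 s0)).
  apply: cvg_row => i; under eq_fun do rewrite mxE.
  by rewrite mxE; case: ifP => _; [exact: cvg_id|exact: cvg_cst].
pose g w s := F (G (subst_coord w i0 s)) 0 i0.
have gc w : pos_orthant w -> forall s : R, 0 < s -> {for s, continuous (g w)}.
  move=> w0 s s0; apply: (@continuous_comp _ _ _ _ (fun t => F t 0 i0)).
    exact: Tc.
  exact: Fc.
have ginc w (a b : R) : pos_orthant w -> 0 < a -> a < b -> g w a < g w b.
  move=> w0 a0 ab; apply: locally_increasing => //; first exact: gc.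
  move=> s s0; have [N nN HN] := FP (proj1 (HG _ (sub0 _ _ w0 s0))).
  have h1 : \forall z \near s, N (G (subst_coord w i0 z)) := Tc w w0 s s0 _ nN.
  have h2 : \forall z \near s, 0 < z by exact: lt_nbhsr.
  have Ns := nbhs_singleton nN.
  apply: filterS2 h1 h2 => z Nz z0 zs.
  have zsneq : G (subst_coord w i0 s) != G (subst_coord w i0 z).
    by apply/eqP => /rowP/(_ i0); rewrite !Gi0// => /eqP; rewrite gt_eqF.
  (* For [i < p] the two points have equal values of [F], for [i > p] equal coordinates; the product
     can only be positive at [i0]. *)
  have [i hi] := HN _ _ Ns Nz zsneq.
  have [_ /rowP/(_ i)] := HG _ (sub0 _ _ w0 s0).
  have [_ /rowP/(_ i)] := HG _ (sub0 _ _ w0 z0).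
  rewrite !mxE; have [ii0|ii0] := eqVneq i i0.
    by move=> _ _; move: hi; rewrite ii0 !Gi0// pmulr_rgt0 ?subr_gt0.
  by case: ifP => _ e1 e2; move: hi; rewrite e1 e2 subrr ?mulr0 ?mul0r ltxx.
have E_succ t : elim_map p.+1 t = subst_coord (elim_map p t) i0 (F t 0 i0).
  apply/rowP => i; rewrite !mxE ltnS leq_eqVlt.
  by have [->|ne] := eqVneq i i0; [rewrite /= eqxx|
     rewrite (_ : (val i == p) = false)//; apply/eqP => h; move/eqP: ne; apply; exact: val_inj].
have EG_sub w t : pos_orthant w -> pos_orthant t ->
    (forall i, i != i0 -> elim_map p t 0 i = w 0 i) ->
    G (subst_coord w i0 (t 0 i0)) = t.
  move=> w0 t0 tw; have [G0 EG] := HG _ (sub0 _ _ w0 (t0 i0)).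
  apply: inj_p; rewrite ?inE// EG; apply/rowP => i; rewrite mxE.
  by case: eqVneq => [->|/tw <-//]; rewrite mxE ltnn.
split=> [x y /set_mem x0 /set_mem y0 Exy|w w0].
  have w0 := (let: And4 _ h _ _ := elim_map_proper p.+1 in h) x x0.
  set w := elim_map p.+1 x in Exy w0.
  have xE : G (subst_coord w i0 (x 0 i0)) = x.
    by apply: EG_sub => // i ii0; rewrite /w E_succ [RHS]mxE (negbTE ii0).
  have yE : G (subst_coord w i0 (y 0 i0)) = y.
    by apply: EG_sub => // i ii0; rewrite Exy E_succ [RHS]mxE (negbTE ii0).
  have gxy : g w (x 0 i0) = g w (y 0 i0).
    by rewrite /g xE yE; move: Exy; rewrite /w !E_succ => /rowP/(_ i0);
      rewrite !mxE eqxx.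
  suff : x 0 i0 = y 0 i0 by move=> h; rewrite -xE -yE h.
  have [h|h|//] := ltgtP (x 0 i0) (y 0 i0).
    by have := ginc w _ _ w0 (x0 i0) h; rewrite gxy ltxx.
  by have := ginc w _ _ w0 (y0 i0) h; rewrite gxy ltxx.
(* [s2] exceeds the properness bound [B0], so the value there lies above the target [w 0 i0]. *)
have [B0 HB0] := Fup (w 0 i0).
pose s2 := Num.max 1 (B0 + 1).
have s20 : 0 < s2 by rewrite lt_max ltr01.
have g2 : w 0 i0 < g w s2.
  rewrite ltNge; apply/negP => /(HB0 _ (proj1 (HG _ (sub0 _ _ w0 s20)))).
  by rewrite Gi0// /s2 ge_max => /andP[_]; rewrite gerDl ler10.
(* As long as [s <= 1], [B1] bounds every coordinate of [G (subst_coord w i0 s)]. A value at least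
   [w 0 i0] would then force [b1 <= s], which the choice [s1 <= b1 / 2] excludes. *)
have [_ _ Eup _] := elim_map_proper p.
have [B1 HB1] := Eup (1 + \sum_i w 0 i).
have [b1 b10 Hb1] := Flow B1 _ (w0 i0).
pose s1 := Num.min (Num.min 1 s2) (b1 / 2).
have s10 : 0 < s1 by rewrite !lt_min ltr01 s20 divr_gt0.
have g1 : g w s1 < w 0 i0.
  rewrite ltNge; apply/negP => h.
  have [G0 EG] := HG _ (sub0 _ _ w0 s10).
  have h1 : s1 <= b1 / 2 by rewrite /s1 ge_min lexx orbT.
  suff : b1 <= s1 by move: b10 h1; lra.
  rewrite -(Gi0 w s1)//; apply: Hb1 => // j; apply: HB1 => //; rewrite EG mxE; case: ifP => _.
    rewrite /s1; apply: (@le_trans _ _ 1); first by rewrite !ge_min lexx.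
    by rewrite lerDl sumr_ge0// => i _; exact: ltW.
  rewrite (bigD1 j)//= addrCA lerDl addr_ge0// sumr_ge0// => i _; exact: ltW.
have s12 : s1 <= s2 by rewrite /s1 !ge_min lexx orbT.
have gw : {within `[s1, s2], continuous (g w)}.
  apply: continuous_in_subspaceT => x; rewrite inE/= in_itv/= => /andP[ax _].
  by apply: gc => //; exact: lt_le_trans ax.
have [|s /[!in_itv]/= /andP[s1s _] gs] := IVT (v := w 0 i0) s12 gw.
  by rewrite ge_min le_max (ltW g1) (ltW g2) orbT.
have s0 : 0 < s by exact: lt_le_trans s1s.
have [G0 EG] := HG _ (sub0 _ _ w0 s0).
exists (G (subst_coord w i0 s)); split => //.
rewrite E_succ EG; apply/rowP => i; rewrite !mxE; case: eqVneq => // ->.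
by rewrite -gs.
Qed.

Theorem P_function_homeo : exists G : 'rV[R]_r -> 'rV[R]_r,
  [/\ forall w, pos_orthant w -> pos_orthant (G w) /\ F (G w) = w,
      forall t, pos_orthant t -> G (F t) = t
    & forall w, pos_orthant w -> G @ w --> G w].
Proof.
have [inj surj] := elim_map_bij (leqnn r).
have EF : elim_map r = F by apply/funext => t; apply/rowP => i; rewrite mxE ltn_ord.
rewrite EF in inj surj.
have h w : exists t, pos_orthant w -> pos_orthant t /\ F t = w.
  have [w0|nw0] := pselect (pos_orthant w); last by exists w.
  by have [t ?] := surj w w0; exists t.
have [G HG] := choice h; exists G; split => //.
  have [_ F0 _ _] := Fproper.
  move=> t t0; have [Gt0 FG] := HG _ (F0 _ t0).
  by apply: inj; rewrite ?inE.
exact: (right_inverse_continuous Fproper inj HG).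
Qed.

End step.
End elimination.

(** * Polynomials with prescribed critical points *)

Section integration.
Variable R : realType.
Implicit Types p q : {poly R}.

(** The antiderivative vanishing at 0: the coefficient of index 0 is a division by zero, hence 0. *)
Definition integ p : {poly R} := \poly_(i < (size p).+1) (p`_i.-1 / i%:R).

Lemma coef_integ p i : (integ p)`_i = p`_i.-1 / i%:R.
Proof.
rewrite coef_poly ltnS; case: leqP => // h.
by rewrite nth_default ?mul0r//; case: i h.
Qed.

Lemma deriv_integ p : (integ p)^`() = p.
Proof.
apply/polyP => i; rewrite coef_deriv coef_integ /= -[_ *+ _]mulr_natr divfK//.
by rewrite pnatr_eq0.
Qed.

Lemma size_integ p : (size (integ p) <= (size p).+1)%N.
Proof. exact: size_poly. Qed.

Lemma eq_deriv_cst p q : p^`() = q^`() -> exists e : R, p = q + e%:P.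
Proof.
move=> pq; exists (p - q)`_0; apply/eqP; rewrite addrC -subr_eq; apply/eqP.
apply/polyP => -[|i]; rewrite coefC//=.
have /polyP/(_ i) := pq; rewrite !coef_deriv coefB => /eqP.
by rewrite -subr_eq0 -mulrnBl mulrn_eq0/= => /eqP.
Qed.

Lemma integ_unique p q : q^`() = p -> q`_0 = 0 -> q = integ p.
Proof.
move=> qp q0; have [e qe] : exists e : R, q = integ p + e%:P.
  by apply: eq_deriv_cst; rewrite deriv_integ.
move: q0; rewrite qe coefD coef_integ invr0 mulr0 add0r coefC/= => ->.
by rewrite addr0.
Qed.

(** The product form covers both sign patterns at once; a zero at [b] itself is allowed, hence the
    half-open interval. *)
Lemma poly_ivt_mul p (a b : R) : a < b -> p.[a] * p.[b] <= 0 -> p.[a] != 0 ->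
  exists2 z, a < z <= b & root p z.
Proof.
move=> ab pab pa0.
have [z /andP[az zb] rz] : exists2 z, a <= z <= b & root p z.
  have [pa|pa] := leP p.[a] 0.
    apply: poly_ivt (ltW ab) _; rewrite pa/=.
    by move: pab; rewrite nmulr_rle0// lt_neqAle pa0.
  have [z zab] : exists2 z, a <= z <= b & root (- p) z.
    apply: poly_ivt (ltW ab) _; rewrite !hornerN oppr_le0 oppr_ge0 (ltW pa)/=.
    by rewrite pmulr_rle0 in pab.
  by rewrite rootN; exists z.
exists z => //; rewrite zb andbT lt_neqAle az andbT.
by apply: contra pa0 => /eqP ->.
Qed.

Lemma roots_between p (x : R) (s : seq R) :
  path (fun a b => `[< exists2 z, a < z < b & root p z >]) x s ->
  exists rs : seq R, [/\ path <%R x rs, all (root p) rs & size rs = size s].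
Proof.
elim: s x => [|y s IH] x /=; first by exists [::].
move=> /andP[/asboolP[z /andP[xz zy] rz] /IH[rs [yrs ars srs]]].
exists (z :: rs); split => /=; rewrite ?xz ?rz ?srs//.
by case: rs yrs {ars srs} => //= w rs /andP[yw ->]; rewrite (lt_trans zy yw).
Qed.

(** The points of [s] leave [size s - 1] gaps with a root in each, while a nonzero [p] would have
    degree at most [size s - 2]. *)
Lemma separated_roots_eq0 p (s : seq R) :
  sorted (fun a b => `[< exists2 z, a < z < b & root p z >]) s ->
  (size p < size s)%N -> p = 0.
Proof.
case: s => [//|x s] /= /roots_between[rs [xrs ars srs]].
rewrite ltnS => ps; apply/eqP; apply: contraT => p0.
have urs : uniq rs.
  by apply: (@sorted_uniq _ <%R lt_trans ltxx); exact: path_sorted xrs.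
by have := max_poly_roots p0 ars urs; rewrite srs ltnNge ps.
Qed.

End integration.

(** * Products of weighted linear factors and their signs on the gaps *)

Section weighted_roots.
Variables (R : realType) (k : nat).
Implicit Types (m : 'I_k -> nat) (c : 'rV[R]_k) (i j l : 'I_k).

Definition root_prod m c : {poly R} := \prod_j ('X - (c 0 j)%:P) ^+ m j.

(** Up to the factor N and an additive constant, the value of the polynomial f at its [j]-th point.
    Only differences of these values are invariant under translation. *)
Definition root_val m c j : R := (integ (root_prod m c)).[c 0 j].

Definition increasing c := forall i j, (i < j)%N -> c 0 i < c 0 j.

(* The sign of [root_prod m c] just to the right of the [i]-th point. *)
Definition gap_sign m (i : nat) : R :=
  \prod_(l < k) (if (l <= i)%N then 1 else -1) ^+ m l.

Lemma horner_root_prod m c z : (root_prod m c).[z] = \prod_j (z - c 0 j) ^+ m j.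
Proof.
by rewrite horner_prod; apply: eq_bigr => j _; rewrite horner_exp hornerXsubC.
Qed.

Lemma monic_root_prod m c : root_prod m c \is monic.
Proof. by apply: monic_prod => j _; exact/monic_exp/monicXsubC. Qed.

Lemma size_root_prod m c : size (root_prod m c) = (\sum_j m j).+1.
Proof.
rewrite size_prod => [|j _]; last first.
  by rewrite expf_neq0// polyXsubC_eq0.
rewrite (eq_bigr (fun j => 1 + m j)%N) => [|j _]; last by rewrite size_exp_XsubC.
by rewrite big_split/= -addnS sum1_card addKn.
Qed.

Lemma gap_sign_sq m (i : nat) : gap_sign m i * gap_sign m i = 1.
Proof.
rewrite -big_split big1//= => l _; rewrite -exprMn.
by case: ifP => _; rewrite ?mulrNN mulr1 expr1n.
Qed.

(** The sign turns each factor into the difference that is nonnegative for [z] in the gap, so that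
    positivity and size estimates become factorwise. *)
Lemma gap_sign_horner m c (i : nat) z :
  gap_sign m i * (root_prod m c).[z] =
  \prod_(l < k) (if (l <= i)%N then z - c 0 l else c 0 l - z) ^+ m l.
Proof.
rewrite horner_root_prod -big_split; apply: eq_bigr => l _ /=.
by rewrite -exprMn; case: ifP => _; rewrite ?mul1r// mulN1r opprB.
Qed.

Lemma gap_sign_horner_gt0 m c (i : nat) z : increasing c ->
  (forall l, (l <= i)%N -> c 0 l < z) -> (forall l, (i < l)%N -> z < c 0 l) ->
  0 < gap_sign m i * (root_prod m c).[z].
Proof.
move=> cinc lo hi; rewrite gap_sign_horner; apply: prodr_gt0 => l _.
by apply: exprn_gt0; case: leqP => h; rewrite subr_gt0; [exact: lo|exact: hi].
Qed.

Lemma gap_sign_horner_ge0 m c (i : nat) z :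
  (forall l, (l <= i)%N -> c 0 l <= z) -> (forall l, (i < l)%N -> z <= c 0 l) ->
  0 <= gap_sign m i * (root_prod m c).[z].
Proof.
move=> lo hi; rewrite gap_sign_horner; apply: prodr_ge0 => l _.
by apply: exprn_ge0; case: leqP => h; rewrite subr_ge0; [exact: lo|exact: hi].
Qed.

End weighted_roots.

(** * The infinitesimal P-property *)

Section infinitesimal_P.
Variables (R : realType) (k : nat) (m : 'I_k -> nat) (c : 'rV[R]_k).
Hypothesis cinc : increasing c.
Implicit Types (i j l : 'I_k) (d : 'I_k -> R) (D : {poly R}).

Let P := root_prod m c.
Let G d z : R := \sum_j (m j)%:R * d j / (z - c 0 j).
Let W d D j : R := (integ D).[c 0 j] + P.[c 0 j] * d j.

(* [D] is the derivative of [root_prod m c] when each point [c 0 j] moves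
   with velocity [d j], and [W d D j] that of [root_val m c j]. *)
Let variation d D := forall z, (forall j, z != c 0 j) -> D.[z] = - (P.[z] * G d z).

Lemma increasing_mono i j : (c 0 i < c 0 j) = (i < j)%N.
Proof.
have [ij|ji|/val_inj ->] := ltngtP i j; last exact: ltxx.
  exact: cinc.
by apply/negbTE; rewrite -leNgt ltW// cinc.
Qed.

Lemma increasing_inj : injective (c 0).
Proof.
move=> i j cij; apply/val_inj/eqP; rewrite eqn_leq leqNgt -increasing_mono.
by rewrite leqNgt -increasing_mono cij ltxx.
Qed.

Lemma increasing_mono_le i j : (c 0 i <= c 0 j) = (i <= j)%N.
Proof. by rewrite leNgt increasing_mono [RHS]leqNgt. Qed.

Lemma in_gap i i' z : i' = i.+1 :> nat -> c 0 i < z < c 0 i' ->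
  (forall l, (l <= i)%N -> c 0 l < z) /\ (forall l, (i < l)%N -> z < c 0 l).
Proof.
move=> ii' /andP[iz zi']; split=> l h.
  by apply: le_lt_trans iz; rewrite increasing_mono_le.
by apply: lt_le_trans zi' _; rewrite increasing_mono_le ii'.
Qed.

Lemma gap_neq i i' z : i' = i.+1 :> nat -> c 0 i < z < c 0 i' ->
  forall j, z != c 0 j.
Proof.
move=> ii' /(in_gap ii')[lo hi] j; rewrite neq_lt.
by case: (leqP j i) => h; [rewrite (lo j h) orbT|rewrite (hi j h)].
Qed.

Lemma gap_sign_end_ge0 i i' l : i' = i.+1 :> nat -> (l == i) || (l == i') ->
  0 <= gap_sign R m i * P.[c 0 l].
Proof.
move=> ii' lii'; apply: gap_sign_horner_ge0 => j ji; rewrite increasing_mono_le.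
  by case/orP: lii' => /eqP -> //; rewrite ii' ltnW.
by case/orP: lii' => /eqP ->; rewrite ?ii' // ltnW.
Qed.

(* Where the residues of [G] at two consecutive moving points have opposite signs,
   a zero between them has to come from the hypothesis on the values. *)
Lemma gap_point d D i i' : variation d D -> i' = i.+1 :> nat ->
  (d i' - d i) * (gap_sign R m i * (W d D i' - W d D i)) <= 0 ->
  d i <= 0 <= d i' -> d i < d i' ->
  exists2 z, c 0 i < z < c 0 i' & 0 <= G d z.
Proof.
move=> dD ii' neg /andP[di di'] lt_d.
have cii' : c 0 i < c 0 i' by rewrite increasing_mono ii'.
(* This mean value point is the witness. If [G d z < 0], then [D.[z] = - (P.[z] * G d z)] has the
   sign of the gap, and the end terms [P.[c 0 i'] * d i'] and [- P.[c 0 i] * d i] push in the same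
   direction, against the hypothesis on the values. *)
have [z /[!in_itv]/= zin Dz] := poly_mvt (integ D) cii'.
exists z => //; rewrite deriv_integ in Dz.
move: neg; rewrite pmulr_rle0 ?subr_gt0// /W.
rewrite (_ : _ - _ = (integ D).[c 0 i'] - (integ D).[c 0 i] +
  (P.[c 0 i'] * d i' - P.[c 0 i] * d i)); last by ring.
rewrite Dz dD; last exact: gap_neq ii' zin.
have [lo hi] := in_gap ii' zin.
have := gap_sign_horner_gt0 m cinc lo hi; rewrite -/P.
have := gap_sign_end_ge0 ii' (_ : (i == i) || (i == i')).
rewrite eqxx => /(_ isT) hi0.
have := gap_sign_end_ge0 ii' (_ : (i' == i) || (i' == i')).
rewrite eqxx orbT => /(_ isT) hi'0.
move: hi0 hi'0; set s := gap_sign R m i; set g := G d z.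
move=> h1 h2 h3 h4.
have {h1} h1 : s * P.[c 0 i] * d i <= 0 by rewrite mulr_ge0_le0.
have {h2} h2 : 0 <= s * P.[c 0 i'] * d i' by rewrite mulr_ge0.
have t0 : 0 < c 0 i' - c 0 i by rewrite subr_gt0.
rewrite leNgt; apply/negP => g0.
have : s * P.[z] * g * (c 0 i' - c 0 i) < 0 by rewrite nmulr_rlt0 ?nmulr_llt0 // pmulr_rlt0.
by move: h4 h1 h2; lra.
Qed.

Lemma sign_crossing d (j j' : 'I_k) : (j < j')%N -> d j < 0 -> 0 < d j' ->
  exists i i', [/\ i' = i.+1 :> nat, (j <= i)%N, (i' <= j')%N, d i <= 0 & 0 < d i'].
Proof.
move=> jj' dj; have [n] := ubnP (j' - j)%N.
elim: n j' jj' => // n IH j' jj' jn dj'.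
have j'0 : (j'.-1 < k)%N by rewrite (leq_ltn_trans (leq_pred _)).
pose p := Ordinal j'0.
have pj' : j' = p.+1 :> nat by rewrite /= prednK// (leq_ltn_trans _ jj').
have [dp|dp] := leP (d p) 0.
  by exists p, j'; split => //; rewrite -ltnS -pj'.
have jp : (j < p)%N.
  rewrite ltn_neqAle -ltnS -pj' jj' andbT; apply/eqP => /val_inj jp.
  by move: dp; rewrite -jp ltNge ltW.
have [|i [i' [? ? ? ? ?]]] := IH p jp _ dp.
  by rewrite (leq_trans _ (_ : j' - j <= n)%N)// pj' subSn// ltnW.
by exists i, i'; split => //; rewrite (leq_trans (_ : i' <= p)%N)// pj'.
Qed.

(** Needed because the poles at [j] and [j'] need not be adjacent points: the sign change of [d] is
    first localised in a single gap, possibly next to boundary points. *)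
Lemma gap_point_between d D (j j' : 'I_k) : variation d D ->
  (forall i i', i' = i.+1 :> nat ->
     (d i' - d i) * (gap_sign R m i * (W d D i' - W d D i)) <= 0) ->
  (j < j')%N -> d j < 0 -> 0 < d j' ->
  exists2 z, c 0 j < z < c 0 j' & 0 <= G d z.
Proof.
move=> dD neg jj' dj dj'.
have [i [i' [ii' ji i'j' di di']]] := sign_crossing jj' dj dj'.
have [||z /andP[iz zi'] Gz] := gap_point dD ii' (neg _ _ ii').
- by rewrite di ltW.
- exact: le_lt_trans di'.
exists z => //; apply/andP; split.
  by apply: le_lt_trans iz; rewrite increasing_mono_le.
by apply: lt_le_trans zi' _; rewrite increasing_mono_le.
Qed.

Let horner_integN D x : (integ (- D)).[x] = - (integ D).[x].
Proof.
rewrite -hornerN; congr (_.[_]); apply/esym/integ_unique.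
  by rewrite derivN deriv_integ.
by rewrite coefN coef_integ invr0 mulr0 oppr0.
Qed.

Let GN d z : G (fun j => - d j) z = - G d z.
Proof. by rewrite /G -sumrN; apply: eq_bigr => j _; rewrite mulrN mulNr. Qed.

Let WN d D j : W (fun j => - d j) (- D) j = - W d D j.
Proof. by rewrite /W horner_integN mulrN opprD. Qed.

Section no_poles_moving.
Variables (d : 'I_k -> R) (D : {poly R}).
Hypothesis dD : variation d D.
Hypothesis neg : forall i i', i' = i.+1 :> nat ->
  (d i' - d i) * (gap_sign R m i * (W d D i' - W d D i)) <= 0.
Hypothesis still : forall j, (m j)%:R * d j = 0.

(** No root moves, so [G d] and hence [D] vanish inside the gap, and [integ D] takes the same value
    at both ends. *)
Lemma still_W i i' : i' = i.+1 :> nat ->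
  W d D i' - W d D i = P.[c 0 i'] * d i' - P.[c 0 i] * d i.
Proof.
move=> ii'; have cii' : c 0 i < c 0 i' by rewrite increasing_mono ii'.
have [z /[!in_itv]/= zin] := poly_mvt (integ D) cii'.
rewrite deriv_integ dD; last exact: gap_neq ii' zin.
rewrite /G big1 => [|j _]; last by rewrite still mul0r.
rewrite mulr0 oppr0 mul0r => /eqP; rewrite subr_eq0 => /eqP e.
by rewrite /W e; ring.
Qed.

(** Only points of multiplicity 0 can move, along a fixed polynomial. If [m = 0], then [P = 1] and
    the hypothesis says that a square is nonpositive. Otherwise some root is at rest, and rest
    spreads to its neighbours: a neighbouring root is at rest anyway, and for a neighbouring
    boundary point the hypothesis reads positive times [d ^+ 2 <= 0]. *)
Lemma still_const : forall i i', i' = i.+1 :> nat -> d i' = d i.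
Proof.
have [[j mj]|m0] := pselect (exists j, m j != 0%N); last first.
  have {}m0 j : m j = 0%N by apply: contrapT => h; apply: m0; exists j; exact/eqP.
  have P1 : P = 1 by rewrite /P /root_prod big1// => j _; rewrite m0.
  move=> i i' ii'; have := neg ii'; rewrite still_W// P1 !hornerC !mul1r.
  rewrite /gap_sign big1 => [|l _]; last by rewrite m0.
  rewrite mul1r -expr2 => h; apply/eqP; rewrite -subr_eq0 -sqrf_eq0 eq_le h.
  exact: sqr_ge0.
have dj : d j = 0.
  by move/eqP: (still j); rewrite mulf_eq0 pnatr_eq0 (negbTE mj)/= => /eqP.
have pos i i' l : i' = i.+1 :> nat -> (l == i) || (l == i') -> m l = 0%N ->
    0 < gap_sign R m i * P.[c 0 l].
  move=> ii' lii' ml; rewrite lt_neqAle (gap_sign_end_ge0 ii')// andbT eq_sym mulf_neq0//.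
    by apply/eqP => e; have /eqP := gap_sign_sq R m i; rewrite e mul0r eq_sym oner_eq0.
  rewrite horner_root_prod; apply/prodf_neq0 => x _.
  have [->|xl] := eqVneq x l; first by rewrite ml oner_neq0.
  by rewrite expf_neq0// subr_eq0; apply: contra xl => /eqP/increasing_inj ->.
have d0 l : m l != 0%N -> d l = 0.
  move=> ml; move/eqP: (still l).
  by rewrite mulf_eq0 pnatr_eq0 (negbTE ml)/= => /eqP.
have step i i' : i' = i.+1 :> nat -> (d i == 0) = (d i' == 0).
  move=> ii'; have := neg ii'; rewrite still_W//; set s := gap_sign R m i => h.
  apply/eqP/eqP => e.
    have [/eqP mi'|/d0//] := boolP (m i' == 0%N).
    have := pos i i' i' ii' _ mi'; rewrite eqxx orbT => /(_ isT) ps.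
    move: h; rewrite e subr0 mulr0 subr0 -/s (_ : _ * _ = s * P.[c 0 i'] * d i' ^+ 2); last by ring.
    by rewrite pmulr_rle0// => h; apply/eqP; rewrite -sqrf_eq0 eq_le h sqr_ge0.
  have [/eqP mi|/d0//] := boolP (m i == 0%N).
  have := pos i i' i ii' _ mi; rewrite eqxx => /(_ isT) ps.
  move: h; rewrite e mulr0 -/s (_ : _ * _ = s * P.[c 0 i] * d i ^+ 2); last by ring.
  by rewrite pmulr_rle0// => h; apply/eqP; rewrite -sqrf_eq0 eq_le h sqr_ge0.
(* The right-hand index is 0; it is built from [i] because [k] is not known to be a successor. *)
have all0 n i : (i <= n)%N -> (d i == 0) = (d (Ordinal (leq_ltn_trans (leq0n i) (ltn_ord i))) == 0).
  elim: n i => [|n IH] i.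
    by rewrite leqn0 => /eqP i0; congr (d _ == 0); exact: val_inj.
  rewrite leq_eqVlt => /orP[/eqP in1|/IH//].
  have nk : (n < k)%N by rewrite -ltnS -in1 ltnW// ltnS.
  rewrite -(@step (Ordinal nk) i)// IH//.
  by congr (d _ == 0); exact: val_inj.
have dz i : d i = 0.
  apply/eqP; rewrite (all0 i i)//.
  have := all0 j j (leqnn _); rewrite dj eqxx => /esym.
  by congr (d _ == 0); exact: val_inj.
by move=> i i' _; rewrite !dz.
Qed.

End no_poles_moving.

(** [A] indexes the poles with nonzero residue [w j], and [q] is the numerator of [G d] over the
    common denominator, the product of the [z - c 0 l] for [l] in [A]. If [A] is empty,
    [still_const] concludes; otherwise [q] has more roots than its degree allows, although it is
    nonzero at the poles. *)
Lemma infinitesimal_P d D : variation d D -> \sum_j (m j)%:R * d j = 0 ->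
  (forall i i', i' = i.+1 :> nat ->
     (d i' - d i) * (gap_sign R m i * (W d D i' - W d D i)) <= 0) ->
  forall i i', i' = i.+1 :> nat -> d i' = d i.
Proof.
move=> dD sum0 neg.
pose w j := (m j)%:R * d j; pose A := [set j | w j != 0]%SET.
suff A0 : A = finset.set0.
  apply: (still_const dD neg) => j; apply/eqP; apply: contraT => wj.
  by have : j \in A; [rewrite inE|rewrite A0 finset.in_set0].
apply/eqP; rewrite -cards_eq0; apply: contraT; rewrite -lt0n => A0.
have [j0 j0A] : exists j0, j0 \in A by apply/card_gt0P.
pose pA j : {poly R} := \prod_(l in A :\ j) ('X - (c 0 l)%:P).
pose q := \sum_(j in A) w j *: pA j.
have szpA j : j \in A -> size (pA j) = #|A|.
  by move=> jA; rewrite /pA -big_enum size_prod_XsubC -cardE [in RHS](cardsD1 j) jA.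
have monpA j : pA j \is monic.
  by apply: monic_prod => l _; exact: monicXsubC.
(* All [pA j] are monic of degree [#|A| - 1], so the top coefficient of [q] is the sum of the [w j],
   which the normalisation makes 0. *)
have szq : (size q < #|A|)%N.
  rewrite -(prednK A0) ltnS; apply/leq_sizeP => i; rewrite leq_eqVlt => ii.
  rewrite coef_sum; case/orP: ii => [/eqP <-|ii]; last first.
    rewrite big1// => j jA; rewrite coefZ nth_default ?mulr0// szpA//.
    by rewrite -(prednK A0).
  rewrite (eq_bigr w) => [|j jA]; last first.
    rewrite coefZ (_ : _`_ _ = 1) ?mulr1//.
    by have /monicP := monpA j; rewrite lead_coefE szpA.
  rewrite -[RHS]sum0 [RHS](bigID (mem A))/= [X in _ = _ + X]big1 ?addr0// => j.
  by rewrite inE negbK => /eqP.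
have hornerq z : q.[z] = \sum_(j in A) w j * \prod_(l in A :\ j) (z - c 0 l).
  rewrite horner_sum; apply: eq_bigr => j _; rewrite hornerZ horner_prod.
  by congr (_ * _); apply: eq_bigr => l _; rewrite hornerXsubC.
have qc j : j \in A -> q.[c 0 j] = w j * \prod_(l in A :\ j) (c 0 j - c 0 l).
  move=> jA; rewrite hornerq (bigD1 j)//= [X in _ + X]big1 ?addr0// => i /andP[iA ij].
  by rewrite (big_setD1 j) ?in_setD1 1?eq_sym ?ij//= subrr mul0r mulr0.
have qc0 j : j \in A -> q.[c 0 j] != 0.
  move=> jA; rewrite qc// mulf_neq0//; first by rewrite inE in jA.
  apply/prodf_neq0 => l; rewrite in_setD1 => /andP[lj _].
  by rewrite subr_eq0; apply: contra lj => /eqP/increasing_inj ->.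
have GA z : G d z = \sum_(j in A) w j / (z - c 0 j).
  rewrite /G (bigID (mem A))/= [X in _ + X]big1 ?addr0// => j.
  by rewrite inE negbK /w => /eqP ->; rewrite mul0r.
have qG z : (forall j, j \in A -> z != c 0 j) -> q.[z] = G d z * \prod_(l in A) (z - c 0 l).
  move=> zc; rewrite hornerq GA mulr_suml; apply: eq_bigr => j jA.
  rewrite [in RHS](big_setD1 j)//= mulrA divfK//.
  by rewrite subr_eq0 zc.
have /(@separated_roots_eq0 _ q) : sorted
    (fun a b => `[< exists2 z, a < z < b & root q z >]) [seq c 0 j | j <- enum A].
  apply/(sortedP (c 0 j0)) => n; rewrite size_map => nA.
  rewrite !(nth_map j0)//; last exact: ltnW.
  set j := nth j0 _ n; set j' := nth j0 _ n.+1.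
  have sA : sorted (fun i i' : 'I_k => (i < i')%N) (enum A).
    rewrite /enum_mem -enumT; apply: sorted_filter => [? ? ?|]; first exact: ltn_trans.
    by have := iota_ltn_sorted 0 k; rewrite -val_enum_ord sorted_map.
  have nthmono a b : (a < size (enum A))%N -> (b < size (enum A))%N -> (a < b)%N ->
      (nth j0 (enum A) a < nth j0 (enum A) b)%N.
    move=> aA bA; apply: (sorted_ltn_nth _ j0 sA); rewrite ?inE//.
    by move=> ? ? ?; exact: ltn_trans.
  have jA : j \in A by rewrite -mem_enum mem_nth// ltnW.
  have j'A : j' \in A by rewrite -mem_enum mem_nth.
  have jj' : (j < j')%N by apply: nthmono => //; exact: ltnW.
  have cjj' : c 0 j < c 0 j' by exact: cinc.
  have nomid l : l \in A -> l != j -> l != j' -> (l < j)%N || (j' < l)%N.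
    rewrite -mem_enum => lA lj lj'.
    rewrite -(nth_index j0 lA) in lj lj' *.
    move: lA; rewrite -index_mem; set a := index _ _ => aA.
    case: (ltngtP a n) => an.
    - by rewrite nthmono// ltnW.
    - rewrite orbC nthmono// ltn_neqAle an andbT.
      by apply: contraNneq lj' => an'; rewrite -/a -an'.
    - by move: lj; rewrite -/a an /j eqxx.
  apply/asboolP.
  (* Up to a positive factor [q.[c 0 j] * q.[z]] equals [w j * G d z], because no other pole of [A]
     lies between [c 0 j] and [z]. A point with [w j * G d z <= 0] therefore yields a root in the
     gap. *)
  have [[z /andP[jz zj'] wGz]|noz] :=
      pselect (exists2 z, c 0 j < z < c 0 j' & w j * G d z <= 0).
    have zc l : l \in A -> l != j -> 0 < (c 0 j - c 0 l) * (z - c 0 l).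
      move=> lA lj; have [->|lj'] := eqVneq l j'.
        by rewrite nmulr_rgt0 ?subr_lt0.
      have /orP[h|h] := nomid l lA lj lj'.
        by rewrite mulr_gt0// subr_gt0 ?cinc// (lt_trans _ jz)// cinc.
      by rewrite nmulr_rgt0 subr_lt0 ?cinc ?(lt_trans zj')// ?cinc// (ltn_trans jj').
    have qjz : q.[c 0 j] * q.[z] <= 0.
      rewrite qc// qG => [|l lA]; last first.
        have [->|lj] := eqVneq l j; first by rewrite gt_eqF.
        by apply/eqP => e; have := zc l lA lj; rewrite e subrr mulr0 ltxx.
      rewrite [X in _ * (_ * X)](big_setD1 j)//= mulrACA pmulr_lle0// mulrCA.
      rewrite mulr_gt0 ?subr_gt0// -big_split prodr_gt0//= => l.
      by rewrite in_setD1 => /andP[lj lA]; exact: zc.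
    have [y /andP[jy yz] ry] := poly_ivt_mul jz qjz (qc0 _ jA).
    by exists y => //; rewrite jy (le_lt_trans yz).
  have wd l : w l < 0 -> d l < 0.
    by rewrite /w => h; rewrite ltNge; apply/negP => dl;
      move: h; rewrite ltNge mulr_ge0.
  have wd' l : 0 < w l -> 0 < d l.
    by rewrite /w => h; rewrite ltNge; apply/negP => dl;
      move: h; rewrite ltNge mulr_ge0_le0.
  have w0 l : l \in A -> w l != 0 by rewrite inE.
  (* Residues of opposite signs are impossible here: [gap_point_between], for [d] or for its
     opposite, would produce the point excluded by [noz]. *)
  have ww : 0 < w j * w j'.
    rewrite lt_neqAle eq_sym mulf_neq0 ?w0//= leNgt; apply/negP => ww; apply: noz.
    have [wj|wj] := ltP (w j) 0.
      have wj' : 0 < w j' by rewrite nmulr_rlt0 in ww.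
      have [z zin Gz] := gap_point_between dD neg jj' (wd _ wj) (wd' _ wj').
      by exists z => //; rewrite nmulr_rle0.
    have {}wj : 0 < w j by rewrite lt_neqAle wj eq_sym w0.
    have wj' : w j' < 0 by rewrite pmulr_rlt0 in ww.
    have [|||||z zin Gz] := @gap_point_between (fun l => - d l) (- D) j j'.
    - by move=> z zc; rewrite hornerN dD// GN mulrN.
    - move=> i i' ii'; rewrite !WN; have := neg i i' ii'.
      by move=> h; apply: le_trans h; rewrite le_eqVlt; apply/orP; left; apply/eqP; ring.
    - exact: jj'.
    - by rewrite oppr_lt0 wd'.
    - by rewrite oppr_gt0 wd.
    by exists z => //; rewrite pmulr_rle0//; move: Gz; rewrite GN oppr_ge0.
  have jj'neq : j' != j by apply: contraTneq jj' => ->; rewrite ltnn.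
  (* The factors of every other pole agree in sign at both ends, so the negative product of
     [c 0 j - c 0 j'] and [c 0 j' - c 0 j] decides. *)
  have qjj' : q.[c 0 j] * q.[c 0 j'] <= 0.
    rewrite !qc// (big_setD1 j') ?in_setD1 ?jj'neq//=.
    rewrite [in X in _ * X](big_setD1 j) ?in_setD1 ?(eq_sym j) ?jj'neq//=.
    rewrite (_ : A :\ j :\ j' = A :\ j' :\ j)%SET; last first.
      by apply/setP => x; rewrite !inE; case: (x == j); case: (x == j').
    set X := \prod_(_ in _) (c 0 j - _); set Y := \prod_(_ in _) (c 0 j' - _).
    rewrite (_ : _ * _ = - ((w j * w j') * (c 0 j' - c 0 j) ^+ 2 * (X * Y))); last by ring.
    rewrite oppr_le0 mulr_ge0//; first by rewrite mulr_ge0 ?sqr_ge0 ?ltW.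
    rewrite /X /Y -big_split prodr_ge0//= => l; rewrite !in_setD1 => /and3P[lj lj' lA].
    have /orP[h|h] := nomid l lA lj lj'.
      by rewrite mulr_ge0// subr_ge0 ltW// cinc// (ltn_trans h).
    by rewrite mulr_le0// subr_le0 ltW// cinc// (ltn_trans jj').
  have [y /andP[jy yj'] ry] := poly_ivt_mul cjj' qjj' (qc0 _ jA).
  exists y => //; rewrite jy lt_neqAle yj' andbT.
  by apply: contra (qc0 _ j'A) => /eqP <-.
rewrite size_map -cardE szq => /(_ isT) q0.
by have := qc0 _ j0A; rewrite q0 horner0 eqxx.
Qed.

End infinitesimal_P.

(** * From the infinitesimal to the local P-property *)

Section strict_differentiability.
Variables (R : realType) (r : nat).
Local Notation V := 'rV[R]_r.
Implicit Types (x y u : V) (f g : V -> R) (df dg : V -> V -> R).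

(* A strengthening of C^1 which only involves continuity: the slopes of [f]
   along all chords extend continuously to the diagonal, where they give the
   differential [df]. *)
Definition has_slopes f df := continuous f /\ exists s : V -> V -> V -> R,
  [/\ forall x y, f x - f y = s x y (x - y),
      forall x y (a : R) u, s x y (a *: u) = a * s x y u,
      continuous (fun z : V * V * V => s z.1.1 z.1.2 z.2)
    & forall x u, s x x u = df x u].

Lemma has_slopes_cst (a : R) : has_slopes (fun _ => a) (fun _ _ => 0).
Proof.
split; first exact: cst_continuous.
exists (fun _ _ _ => 0); split => //; first by move=> *; rewrite subrr.
  by move=> *; rewrite mulr0.
exact: cst_continuous.
Qed.

Lemma has_slopes_linear f : continuous f ->
  (forall x y, f (x - y) = f x - f y) -> (forall (a : R) u, f (a *: u) = a * f u) ->
  has_slopes f (fun _ => f).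
Proof.
move=> fc fB fZ; split=> //; exists (fun _ _ => f); split => //.
move=> z; apply: (@continuous_comp _ _ _ (fun z : V * V * V => z.2) f).
  exact: cvg_snd.
exact: fc.
Qed.

Lemma has_slopesD f df g dg : has_slopes f df -> has_slopes g dg ->
  has_slopes (fun x => f x + g x) (fun x u => df x u + dg x u).
Proof.
move=> [fc [s [sE sZ sc sd]]] [gc [s' [sE' sZ' sc' sd']]]; split.
  by move=> x; apply: continuousD; [exact: fc|exact: gc].
exists (fun x y u => s x y u + s' x y u); split.
- by move=> x y; rewrite -sE -sE'; ring.
- by move=> x y a u; rewrite sZ sZ'; ring.
- by move=> z; apply: continuousD; [exact: sc|exact: sc'].
- by move=> x u; rewrite sd sd'.
Qed.

Lemma has_slopesM f df g dg : has_slopes f df -> has_slopes g dg ->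
  has_slopes (fun x => f x * g x) (fun x u => f x * dg x u + df x u * g x).
Proof.
move=> [fc [s [sE sZ sc sd]]] [gc [s' [sE' sZ' sc' sd']]]; split.
  by move=> x; apply: continuousM; [exact: fc|exact: gc].
exists (fun x y u => f x * s' x y u + s x y u * g y); split.
- by move=> x y; rewrite -sE -sE'; ring.
- by move=> x y a u; rewrite sZ sZ'; ring.
- move=> z; apply: (@continuousD _ _ _ (fun z : V * V * V => f z.1.1 * s' z.1.1 z.1.2 z.2)
      (fun z : V * V * V => s z.1.1 z.1.2 z.2 * g z.1.2));
    apply: continuousM; [|exact: sc'|exact: sc|].
    apply: (@continuous_comp _ _ _ (fun z : V * V * V => z.1.1) f).
      by apply: continuous_comp; exact: cvg_fst.
    exact: fc.
  apply: (@continuous_comp _ _ _ (fun z : V * V * V => z.1.2) g).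
    by apply: continuous_comp; [exact: cvg_fst|exact: cvg_snd].
  exact: gc.
- by move=> x u; rewrite sd sd'.
Qed.

Lemma eq_has_slopes f df f' df' : f =1 f' -> (forall x, df x =1 df' x) ->
  has_slopes f df -> has_slopes f' df'.
Proof.
move=> /funext <- dff'; have -> // : df' = df.
by apply/funext => x; apply/funext => u; rewrite dff'.
Qed.

Lemma has_slopesZ (a : R) f df : has_slopes f df ->
  has_slopes (fun x => a * f x) (fun x u => a * df x u).
Proof.
move=> fS; apply: eq_has_slopes (has_slopesM (has_slopes_cst a) fS) => // x u.
by rewrite mul0r addr0.
Qed.

Lemma has_slopesB f df g dg : has_slopes f df -> has_slopes g dg ->
  has_slopes (fun x => f x - g x) (fun x u => df x u - dg x u).
Proof.
move=> fS /(has_slopesZ (-1)) gS.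
by apply: eq_has_slopes (has_slopesD fS gS) => [x|x u]; rewrite mulN1r.
Qed.

Lemma has_slopes_sum n (f : 'I_n -> V -> R) (df : 'I_n -> V -> V -> R) :
  (forall i, has_slopes (f i) (df i)) ->
  has_slopes (fun x => \sum_i f i x) (fun x u => \sum_i df i x u).
Proof.
elim: n f df => [|n IH] f df fS.
  by apply: eq_has_slopes (has_slopes_cst 0) => [x|x u]; rewrite big_ord0.
apply: eq_has_slopes (has_slopesD (fS ord0) (IH _ _ (fun i => fS (lift ord0 i)))).
  by move=> x; rewrite big_ord_recl.
by move=> x u; rewrite big_ord_recl.
Qed.

Lemma has_slopesX n f df : has_slopes f df ->
  has_slopes (fun x => f x ^+ n) (fun x u => f x ^+ n.-1 *+ n * df x u).
Proof.
move=> fS; elim: n => [|n IH].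
  by apply: eq_has_slopes (has_slopes_cst 1) => // x u; rewrite mulr0n mul0r.
apply: eq_has_slopes (has_slopesM fS IH) => [x|x u]; first by rewrite exprS.
case: n {IH} => [|n]; first by rewrite /= expr0 mulr1n mulr0n mul0r mulr0 add0r mulr1 mul1r.
by rewrite /= mulrA mulrnAr -exprS [RHS]mulrDl addrC [df x u * _]mulrC.
Qed.

(** On the diagonal the slopes are the differential, so each unit vector [u] has an index with a
    positive product. By continuity the same index works near [(t, t, u)], compactness of the sphere
    gives one neighbourhood for all [u], and homogeneity of the slopes carries the inequality to
    [x - y]. *)
Lemma local_P_function_of_slopes (F : V -> V) (dF : V -> V -> V) :
  (forall i, has_slopes (fun t => F t 0 i) (fun t u => dF t u 0 i)) ->
  (forall t u, pos_orthant t -> u != 0 -> exists i, 0 < u 0 i * dF t u 0 i) ->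
  local_P_function F.
Proof.
move=> FS FP t t0.
have [s sP] : exists s : 'I_r -> V -> V -> V -> R, forall i,
  [/\ forall x y, F x 0 i - F y 0 i = s i x y (x - y),
      forall x y (a : R) u, s i x y (a *: u) = a * s i x y u,
      continuous (fun z : V * V * V => s i z.1.1 z.1.2 z.2)
    & forall x u, s i x x u = dF x u 0 i].
  by have [s sP] := choice (fun i => (FS i).2); exists s.
pose K := [set u : V | `|u| = 1].
have cK : compact K.
  apply: bounded_closed_compact.
    by exists 1; split => // M M1 u /= ->; exact: ltW.
  rewrite (_ : K = (fun u : V => `|u|) @^-1` [set 1])//.
  by apply: closed_comp; [move=> ? _; exact: norm_continuous|exact: closed_eq].
pose Q (z : V * V) u := exists i, 0 < u 0 i * s i z.1 z.2 u.
have near_Q : \forall z \near (t, t), K `<=` Q z.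
  have ncK := (compact_near_coveringP K).1 cK.
  apply: (ncK _ (nbhs (t, t)) Q _) => u uK.
  have u0 : u != 0 by rewrite -normr_eq0 uK oner_neq0.
  have [i usi] := FP t u t0 u0.
  have [_ _ sc sd] := sP i; rewrite -sd in usi.
  pose h (z : V * V * V) := z.2 0 i * s i z.1.1 z.1.2 z.2.
  have hc : {for (t, t, u), continuous h}.
    apply: continuousM; last exact: sc.
    apply: (@continuous_comp _ _ _ (fun z : V * V * V => z.2) (fun u : V => u 0 i)).
      exact: cvg_snd.
    exact: coord_continuous.
  have := hc _ (lt_nbhsr usi).
  move=> [[A B] /= [nA nB] AB]; exists (B, A) => //= -[u' z] [/= Bu' Az].
  by exists i; exact: (AB (z, u')).
have [[A B] /= [nA nB] AB] := near_Q.
exists (A `&` B); first exact: filterI.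
move=> x y [Ax _] [_ By] xy.
have nxy : `|x - y| != 0 by rewrite normr_eq0 subr_eq0.
have /(AB (x, y) (conj Ax By))[i +] : K (`|x - y|^-1 *: (x - y)).
  by rewrite /K/= normrZ normfV normr_id mulVf.
have [sE sZ _ _] := sP i.
rewrite /= sZ mxE mulrACA pmulr_rgt0; last first.
  by rewrite mulr_gt0// invr_gt0 lt_neqAle eq_sym nxy normr_ge0.
by move=> h; exists i; rewrite sE; rewrite !mxE in h.
Qed.

End strict_differentiability.

Lemma continuous_sum {R : realType} {T : topologicalType} {I : Type} (s : seq I)
    (P : pred I) (f : I -> T -> R) :
  (forall i, continuous (f i)) -> continuous (fun t => \sum_(i <- s | P i) f i t).
Proof.
move=> fc; elim: s => [|i s IH] t.
  under eq_fun do rewrite big_nil.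
  exact: cst_continuous.
under eq_fun do rewrite big_cons.
case: (P i); last exact: IH.
by apply: continuousD; [exact: fc|exact: IH].
Qed.

(** * Slopes of products and values when the points depend linearly on parameters *)

Section root_families.
Variables (R : realType) (r k : nat) (pt : 'rV[R]_r -> 'rV[R]_k) (m : 'I_k -> nat).
Hypotheses (pt_cont : continuous pt)
  (ptB : forall x y, pt (x - y) = pt x - pt y)
  (ptZ : forall (a : R) x, pt (a *: x) = a *: pt x).
Local Notation V := 'rV[R]_r.
Implicit Types (x u : V) (z : R).

Lemma has_slopes_pt j : has_slopes (fun x => pt x 0 j) (fun _ u => pt u 0 j).
Proof.
apply: has_slopes_linear => [x|x y|a u].
- apply: (@continuous_comp _ _ _ pt (fun v => v 0 j)); first exact: pt_cont.
  exact: coord_continuous.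
- by rewrite ptB !mxE.
- by rewrite ptZ mxE.
Qed.

(* [g] is the logarithmic differential of the family [p]. *)
Definition poly_slopes (n : nat) (p : V -> {poly R}) (g : V -> V -> R -> R) :=
  exists dp : V -> V -> {poly R},
  [/\ forall i, has_slopes (fun x => (p x)`_i) (fun x u => (dp x u)`_i),
      forall x, (size (p x) <= n.+1)%N,
      forall x u, (size (dp x u) <= n.+1)%N
    & forall x u z, (forall j, z != pt x 0 j) -> (dp x u).[z] = (p x).[z] * g x u z].

Lemma poly_slopes1 : poly_slopes 0 (fun _ => 1) (fun _ _ _ => 0).
Proof.
exists (fun _ _ => 0); split => [i|x|x u|x u z _].
- apply: eq_has_slopes (has_slopes_cst _ (1 : {poly R})`_i) => // x u.
  by rewrite coef0.
- by rewrite size_poly1.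
- by rewrite size_poly0.
- by rewrite horner0 mulr0.
Qed.

Lemma poly_slopesXsubC j :
  poly_slopes 1 (fun x => 'X - (pt x 0 j)%:P) (fun x u z => - pt u 0 j / (z - pt x 0 j)).
Proof.
exists (fun _ u => (- pt u 0 j)%:P); split => [i|x|x u|x u z zx].
- have h := has_slopesB (has_slopes_cst _ ('X : {poly R})`_i)
    (has_slopesZ (i == 0%N)%:R (has_slopes_pt j)).
  apply: eq_has_slopes h => [x|x u]; rewrite ?coefB coefC.
    by case: eqP; rewrite ?mul1r ?mul0r.
  by case: eqP; rewrite ?mul1r ?mul0r ?subr0 ?sub0r.
- by rewrite size_XsubC.
- exact: leq_trans (size_polyC_leq1 _) _.
- by rewrite hornerC hornerXsubC mulrC divfK// subr_eq0.
Qed.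

Lemma poly_slopesM n n' p p' g g' : poly_slopes n p g -> poly_slopes n' p' g' ->
  poly_slopes (n + n') (fun x => p x * p' x) (fun x u z => g x u z + g' x u z).
Proof.
have szM (a b : {poly R}) : (size a <= n.+1)%N -> (size b <= n'.+1)%N ->
    (size (a * b)%R <= (n + n').+1)%N.
  move=> ha hb; apply: (leq_trans (size_polyMleq _ _)).
  by rewrite -subn1 leq_subLR add1n -addSn -addnS leq_add.
move=> [dp [dpS sp sdp dpE]] [dp' [dpS' sp' sdp' dpE']].
exists (fun x u => p x * dp' x u + dp x u * p' x); split => [i|x|x u|x u z zx].
- have h := has_slopes_sum (fun j : 'I_i.+1 => has_slopesM (dpS j) (dpS' (i - j)%N)).
  apply: eq_has_slopes h => [x|x u]; first by rewrite coefM.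
  by rewrite coefD !coefM -big_split.
- exact: szM.
- by apply: (leq_trans (size_polyD _ _)); rewrite geq_max !szM.
- by rewrite hornerD !hornerM dpE// dpE'//; ring.
Qed.

Lemma poly_slopesX n p g e : poly_slopes n p g ->
  poly_slopes (e * n) (fun x => p x ^+ e) (fun x u z => e%:R * g x u z).
Proof.
move=> pS; elim: e => [|e [dp [dpS sp sdp dpE]]].
  have [dp [dpS sp sdp dpE]] := poly_slopes1.
  by exists dp; split => // x u z zx; rewrite dpE// mul0r.
have IH : poly_slopes (e * n) (fun x => p x ^+ e) (fun x u z => e%:R * g x u z).
  by exists dp.
have [dp' [dpS' sp' sdp' dpE']] := poly_slopesM pS IH.
exists dp'; split => [i|x|x u|x u z zx].
- by apply: eq_has_slopes (dpS' i) => // x; rewrite exprS.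
- by rewrite exprS mulSn sp'.
- by rewrite mulSn sdp'.
- by rewrite dpE'// exprS -natr1 mulrDl mul1r [g _ _ _ + _]addrC.
Qed.

Lemma poly_slopes_root_prod :
  poly_slopes (\sum_j m j) (fun x => root_prod m (pt x))
    (fun x u z => - \sum_j (m j)%:R * pt u 0 j / (z - pt x 0 j)).
Proof.
suff [dp [dpS sp sdp dpE]] : poly_slopes (\sum_j m j)
    (fun x => \prod_j ('X - (pt x 0 j)%:P) ^+ m j)
    (fun x u z => \sum_j (m j)%:R * (- pt u 0 j / (z - pt x 0 j))).
  exists dp; split => // x u z zx; rewrite dpE//; congr (_ * _).
  by rewrite -sumrN; apply: eq_bigr => j _; rewrite mulNr mulrN mulrA.
elim: (index_enum _) => [|j s IH].
  have [dp [dpS sp sdp dpE]] := poly_slopes1.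
  exists dp; split => [i|x|x u|x u z zx]; rewrite ?big_nil//.
  - by apply: eq_has_slopes (dpS i) => // x; rewrite big_nil.
  - exact: sp.
  - by rewrite dpE.
have [dp [dpS sp sdp dpE]] := poly_slopesM (poly_slopesX (m j) (poly_slopesXsubC j)) IH.
exists dp; split => [i|x|x u|x u z zx].
- by apply: eq_has_slopes (dpS i) => // x; rewrite big_cons.
- by rewrite !big_cons -[X in (X + _)%N]muln1 sp.
- by rewrite big_cons -[X in (X + _)%N]muln1 sdp.
- by rewrite dpE// !big_cons.
Qed.

(** Product rule for the value: one term integrates the variation of the polynomial, the other comes
    from the motion of the evaluation point, where the derivative of the antiderivative is
    [root_prod]. *)
Lemma has_slopes_root_val : exists dp : V -> V -> {poly R},
  (forall x u z, (forall j, z != pt x 0 j) -> (dp x u).[z] =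
     - ((root_prod m (pt x)).[z] * \sum_j (m j)%:R * pt u 0 j / (z - pt x 0 j))) /\
  forall j, has_slopes (fun x => root_val m (pt x) j) (fun x u =>
     (integ (dp x u)).[pt x 0 j] + (root_prod m (pt x)).[pt x 0 j] * pt u 0 j).
Proof.
have [dp [dpS sp sdp dpE]] := poly_slopes_root_prod.
exists dp; split=> [x u z zx|j]; first by rewrite dpE// mulrN.
set M := (\sum_j m j)%N in sp sdp.
have := has_slopes_sum (fun i : 'I_M.+2 => has_slopesM
  (has_slopesZ (i%:R^-1) (dpS i.-1)) (has_slopesX i (has_slopes_pt j))).
(* The uniform degree bound makes the value a sum of fixed length, to which the rules for sums,
   products and powers apply. *)
have wide (q : {poly R}) z : (size q <= M.+1)%N ->
    (integ q).[z] = \sum_(i < M.+2) i%:R^-1 * q`_i.-1 * z ^+ i.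
  move=> sq; rewrite (@horner_coef_wide _ M.+2); last first.
    exact: leq_trans (size_integ _) _.
  by apply: eq_bigr => i _; rewrite coef_integ [_^-1 * _]mulrC.
apply: eq_has_slopes => [x|x u]; first by rewrite /root_val wide.
rewrite wide// (@horner_coef_wide _ M.+1)// big_split/= addrC; congr (_ + _).
rewrite big_ord_recl/= mulr0n mul0r mulr0 add0r mulr_suml.
apply: eq_bigr => i _; rewrite /bump/= add1n.
rewrite [_^-1 * _]mulrC -!mulrA; congr (_ * _).
by rewrite add0n -[_ ^+ _ *+ _]mulr_natl -mulrA mulKf ?pnatr_eq0.
Qed.

End root_families.

(** * Configurations parametrised by their gaps *)

Section gaps.
Variables (R : realType) (r : nat) (m : 'I_r.+1 -> nat).
Local Notation V := 'rV[R]_r.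
Implicit Types (t u x y : V) (i : 'I_r) (j l : 'I_r.+1).

Definition psum t (n : nat) : R := \sum_(i < r | (i < n)%N) t 0 i.

(* The points with consecutive gaps [t], translated so that the sum of the
   roots of [root_prod m] is [0]; when [m = 0] the translation is junk ([x / 0 = 0])
   and the first point is [0]. *)
Definition gap_points t : 'rV[R]_r.+1 :=
  \row_j (psum t j - (\sum_l (m l)%:R * psum t l) / (\sum_l m l)%:R).

Definition gap_lo i : 'I_r.+1 := widen_ord (leqnSn r) i.
Definition gap_hi i : 'I_r.+1 := lift ord0 i.

Lemma psum_linear (a : R) t u n : psum (a *: t + u) n = a * psum t n + psum u n.
Proof.
rewrite /psum mulr_sumr -big_split; apply: eq_bigr => i _.
by rewrite !mxE.
Qed.

Lemma gap_points_linear (a : R) t u :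
  gap_points (a *: t + u) = a *: gap_points t + gap_points u.
Proof.
apply/rowP => j; rewrite !mxE psum_linear.
rewrite (eq_bigr (fun l => a * ((m l)%:R * psum t l) + (m l)%:R * psum u l)).
  by rewrite big_split -mulr_sumr /=; ring.
by move=> l _; rewrite psum_linear; ring.
Qed.

Lemma gap_points0 : gap_points 0 = 0.
Proof. by have := gap_points_linear (-1) 0 0; rewrite scaler0 addr0 scaleN1r addNr. Qed.

Lemma gap_pointsZ (a : R) t : gap_points (a *: t) = a *: gap_points t.
Proof. by rewrite -[a *: t]addr0 gap_points_linear gap_points0 addr0. Qed.

Lemma gap_pointsB x y : gap_points (x - y) = gap_points x - gap_points y.
Proof. by rewrite addrC -scaleN1r gap_points_linear scaleN1r addrC. Qed.

Lemma psum_continuous n : continuous (fun t => psum t n).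
Proof.
by apply: continuous_sum => i; exact: coord_continuous.
Qed.

Lemma gap_points_continuous : continuous gap_points.
Proof.
apply: continuous_row => j.
rewrite (_ : (fun _ => _) = fun t =>
    psum t j - (\sum_l (m l)%:R * psum t l) / (\sum_l m l)%:R); last first.
  by apply/funext => t; rewrite mxE.
move=> t; apply: (@continuousB _ _ _ (psum^~ j)
  (fun t => (\sum_l (m l)%:R * psum t l) / (\sum_l m l)%:R)).
  exact: psum_continuous.
apply: (@continuousM _ _ (fun t => \sum_l (m l)%:R * psum t l)); last exact: cst_continuous.
apply: continuous_sum => l {}t; apply: (@continuousM _ _ (fun=> (m l)%:R) (psum^~ l)).
  exact: cst_continuous.
exact: psum_continuous.
Qed.

Lemma psumS t i : psum t i.+1 = psum t i + t 0 i.
Proof.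
rewrite /psum (bigD1 i)//= addrC; congr (_ + _); apply: eq_bigl => l.
by rewrite ltnS [(l < i)%N]ltn_neqAle andbC.
Qed.

Lemma gap_points_gap t i : gap_points t 0 (gap_hi i) - gap_points t 0 (gap_lo i) = t 0 i.
Proof. by rewrite !mxE /= /bump/= add1n psumS; ring. Qed.

Lemma gap_points_centered t : \sum_j (m j)%:R * gap_points t 0 j = 0.
Proof.
have [M0|M0] := eqVneq (\sum_j m j)%N 0%N.
  rewrite big1// => j _; move/eqP: M0; rewrite sum_nat_eq0 => /forallP/(_ j).
  by move=> /eqP ->; rewrite mul0r.
rewrite (eq_bigr (fun j => (m j)%:R * psum t j - (m j)%:R *
    ((\sum_l (m l)%:R * psum t l) / (\sum_l m l)%:R))); last first.
  by move=> j _; rewrite mxE mulrBr.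
by rewrite sumrB -mulr_suml -natr_sum mulrC divfK ?subrr// pnatr_eq0.
Qed.

Lemma psum_mono t (a b : nat) : pos_orthant t -> (a <= b)%N -> psum t a <= psum t b.
Proof.
move=> t0 ab; rewrite /psum [leRHS](bigID (fun i : 'I_r => (i < a)%N))/=.
rewrite (eq_bigl (fun i : 'I_r => (i < b)%N && (i < a)%N)) ?lerDl ?sumr_ge0//.
  by move=> i _; exact: ltW.
by move=> i /=; case: ltnP => h; rewrite ?andbF// (leq_trans h).
Qed.

Lemma gap_points_increasing t : pos_orthant t -> increasing (gap_points t).
Proof.
move=> t0 j l jl; rewrite !mxE ltrD2r.
have jr : (j < r)%N by rewrite (leq_trans jl)// -ltnS.
have := psum_mono t0 jl; apply: lt_le_trans.
by rewrite -[j.+1]/((Ordinal jr).+1) psumS ltrDl.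
Qed.

Lemma psum_le_total t (n : nat) : pos_orthant t -> 0 <= psum t n <= \sum_i t 0 i.
Proof.
move=> t0; rewrite /psum sumr_ge0 /=; last by move=> i _; exact: ltW.
rewrite [leRHS](bigID (fun i : 'I_r => (i < n)%N))/= lerDl sumr_ge0// => i _.
exact: ltW.
Qed.

(** On the orthant these are the absolute differences of consecutive values. A fixed sign in place
    of the absolute value keeps them polynomial in [t] on the whole space. *)
Definition gap_values t : V := \row_i (gap_sign R m i *
  (root_val m (gap_points t) (gap_hi i) - root_val m (gap_points t) (gap_lo i))).

Lemma gap_loP (j j' : 'I_r.+1) : j' = j.+1 :> nat ->
  exists i, j = gap_lo i /\ j' = gap_hi i.
Proof.
move=> jj'; have jr : (j < r)%N by rewrite -ltnS -jj'.
by exists (Ordinal jr); split; apply: val_inj.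
Qed.

(** Contraposition of [infinitesimal_P] with velocities [gap_points m u]: their gaps are the entries
    of [u], and the normalisation of the velocities is built into [gap_points]. *)
Lemma gap_values_slopes : exists dF : V -> V -> V,
  (forall i, has_slopes (fun t => gap_values t 0 i) (fun t u => dF t u 0 i)) /\
  (forall t u, pos_orthant t -> u != 0 -> exists i, 0 < u 0 i * dF t u 0 i).
Proof.
have [dp [dpE dpS]] := has_slopes_root_val m gap_points_continuous gap_pointsB gap_pointsZ.
pose W t u j := (integ (dp t u)).[gap_points t 0 j] +
  (root_prod m (gap_points t)).[gap_points t 0 j] * gap_points u 0 j.
exists (fun t u => \row_i (gap_sign R m i * (W t u (gap_hi i) - W t u (gap_lo i)))).
split=> [i|t u t0 u0].
  apply: eq_has_slopes (has_slopesZ (gap_sign R m i)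
    (has_slopesB (dpS (gap_hi i)) (dpS (gap_lo i)))) => [t|t u]; by rewrite [RHS]mxE.
apply: contrapT => noi; move/eqP: u0; apply.
apply/rowP => i; rewrite mxE -gap_points_gap; apply/eqP; rewrite subr_eq0; apply/eqP.
apply: (@infinitesimal_P _ _ m _ (gap_points_increasing t0) (gap_points u 0) (dp t u)) => //.
- by move=> z zt; rewrite dpE.
- exact: gap_points_centered.
- move=> _ _ /gap_loP[i' [-> ->]]; rewrite gap_points_gap leNgt; apply/negP => h.
  by apply: noi; exists i'; rewrite mxE.
Qed.

End gaps.

(** * Critical values as coordinates *)

Section gap_values_homeo.
Variables (R : realType) (r : nat) (m : 'I_r.+1 -> nat).
Implicit Types (t : 'rV[R]_r) (i : 'I_r).

Local Notation M := (\sum_l m l)%N.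

Section at_gap.
Variables (t : 'rV[R]_r) (i : 'I_r).
Hypothesis t0 : pos_orthant t.

Let c := gap_points m t.
Let p := root_prod m c.
Let s : R := gap_sign R m i.
Let a := c 0 (gap_lo i).

Let cinc : increasing c := gap_points_increasing m t0.

Let cE : c 0 (gap_hi i) = a + t 0 i.
Proof. by rewrite -(gap_points_gap m t i) addrC subrK. Qed.

Lemma gap_subinterval (x y : R) : a <= x -> x < y -> y <= a + t 0 i ->
  exists2 z, x < z < y & s * ((integ p).[y] - (integ p).[x]) = s * p.[z] * (y - x).
Proof.
move=> ax xy yt; have [z /[!in_itv]/= zxy ->] := poly_mvt (integ p) xy.
by exists z => //; rewrite deriv_integ mulrA.
Qed.

Lemma gap_sign_prod (z : R) : s * p.[z] =
  \prod_(l < r.+1) (if (l <= i)%N then z - c 0 l else c 0 l - z) ^+ m l.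
Proof. exact: gap_sign_horner. Qed.

Lemma gap_dist_lo (z : R) (e : R) (l : 'I_r.+1) : a + e <= z <= a + t 0 i - e ->
  e <= (if (l <= i)%N then z - c 0 l else c 0 l - z).
Proof.
move=> /andP[az zt]; case: leqP => li.
  have : c 0 l <= a by rewrite increasing_mono_le.
  by move: az; lra.
have : c 0 (gap_hi i) <= c 0 l by rewrite increasing_mono_le.
by rewrite cE; move: zt; lra.
Qed.

Lemma gap_dist_hi (z : R) (l : 'I_r.+1) : a <= z <= a + t 0 i ->
  (if (l <= i)%N then z - c 0 l else c 0 l - z) <= \sum_j t 0 j.
Proof.
rewrite -cE /a /c !mxE => /andP[az zt].
have /andP[h1 h2] := psum_le_total (gap_hi i) t0.
have /andP[h3 h4] := psum_le_total (gap_lo i) t0.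
have /andP[h5 h6] := psum_le_total l t0.
by case: leqP => _; move: az zt h1 h2 h3 h4 h5 h6; lra.
Qed.

Lemma gap_sub_ge0 (x y : R) : a <= x -> x <= y -> y <= a + t 0 i ->
  0 <= s * ((integ p).[y] - (integ p).[x]).
Proof.
move=> ax xy yt; have [->|/negP xy'] := eqVneq x y; first by rewrite subrr mulr0.
have {xy'} xy : x < y by rewrite lt_neqAle xy andbT; exact/negP.
have [z /andP[xz zy] ->] := gap_subinterval ax xy yt.
rewrite mulr_ge0 ?subr_ge0 ?(ltW xy)// gap_sign_prod prodr_ge0// => l _.
apply: exprn_ge0; apply: gap_dist_lo; rewrite addr0 subr0.
by rewrite (le_trans ax (ltW xz)) (le_trans (ltW zy) yt).
Qed.

(** Integrate over the middle half of the gap only: it has length [t 0 i / 2], and each of the [M]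
    linear factors is at least [t 0 i / 4] there. *)
Lemma gap_value_ge : (t 0 i / 4) ^+ M * (t 0 i / 2) <= gap_values m t 0 i.
Proof.
have ti : 0 < t 0 i := t0 i.
rewrite mxE -/c -/s /root_val -/p cE -/a.
pose x := a + t 0 i / 4; pose y := a + t 0 i * 3 / 4.
have ax : a <= x by rewrite /x; lra.
have xy : x < y by rewrite /x /y; lra.
have yb : y <= a + t 0 i by rewrite /y; lra.
have h1 := gap_sub_ge0 (lexx a) ax (le_trans (ltW xy) yb).
have h2 := gap_sub_ge0 (le_trans ax (ltW xy)) yb (lexx _).
have [z /andP[xz zy] e] := gap_subinterval ax xy yb.
have : (t 0 i / 4) ^+ M * (t 0 i / 2) <= s * ((integ p).[y] - (integ p).[x]).
  rewrite e (_ : y - x = t 0 i / 2); last by rewrite /x /y; lra.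
  rewrite ler_wpM2r ?divr_ge0 ?(ltW ti)// gap_sign_prod -prodrXr.
  apply: ler_prod => l _; rewrite exprn_ge0 ?divr_ge0 ?(ltW ti)//=.
  apply: lerXn2r; rewrite ?nnegrE ?divr_ge0 ?(ltW ti)//.
    apply: gap_dist_lo; move: xz zy yb; rewrite /x /y addr0 subr0 => *.
    by apply/andP; split; lra.
  by apply: gap_dist_lo; move: xz zy; rewrite /x /y => *; apply/andP; split; lra.
by move: h1 h2; lra.
Qed.

(** Inside the gap each of the [M] linear factors is at most the total length of the
    configuration. *)
Lemma gap_value_le : gap_values m t 0 i <= (\sum_j t 0 j) ^+ M * t 0 i.
Proof.
have ti : 0 < t 0 i := t0 i.
rewrite mxE -/c -/s /root_val -/p cE -/a.
have [|z /andP[az zb] ->] := gap_subinterval (lexx a) _ (lexx _).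
  by rewrite ltrDl.
rewrite [a + _]addrC addrK ler_wpM2r ?(ltW ti)// gap_sign_prod -prodrXr.
have zin : a <= z <= a + t 0 i by rewrite !ltW.
apply: ler_prod => l _; have h : 0 <= (if (l <= i)%N then z - c 0 l else c 0 l - z).
  by apply: gap_dist_lo; rewrite addr0 subr0.
rewrite exprn_ge0//=; apply: lerXn2r; rewrite ?nnegrE//.
  by rewrite sumr_ge0// => j _; exact: ltW.
exact: gap_dist_hi.
Qed.

Lemma gap_value_gt0 : 0 < gap_values m t 0 i.
Proof.
by apply: lt_le_trans gap_value_ge; rewrite mulr_gt0 ?exprn_gt0 ?divr_gt0.
Qed.

End at_gap.

Lemma gap_values_proper : proper_on_orthant (gap_values m : 'rV[R]_r -> _).
Proof.
split=> [i|t t0 i|B|B b b0].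
- by have [dF [/(_ i)[]]] := gap_values_slopes R m.
- exact: gap_value_gt0.
(* Beyond 4 the power in [gap_value_ge] is at least 1, which leaves [t 0 i / 2 <= B]. *)
- exists (Num.max 4 (2 * B)) => t t0 i tB; rewrite le_max.
  have [//|t4 /=] := leP (t 0 i) 4.
  have h : 1 <= (t 0 i / 4) ^+ M by apply: exprn_ege1; lra.
  have := le_trans (gap_value_ge i t0) tB.
  have : 1 * (t 0 i / 2) <= (t 0 i / 4) ^+ M * (t 0 i / 2).
    by rewrite ler_wpM2r//; lra.
  lra.
(* [L] bounds the total length; the summand 1 keeps it positive. *)
- pose L := 1 + \sum_(j < r) `|B|; exists (b / L ^+ M).
    by rewrite divr_gt0 ?exprn_gt0// ltr_wpDr// sumr_ge0.
  move=> t t0 tB i bt.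
  have L0 : 0 < L by rewrite ltr_wpDr// sumr_ge0.
  rewrite ler_pdivrMr ?exprn_gt0// mulrC; apply: (le_trans bt).
  apply: (le_trans (gap_value_le i t0)).
  rewrite ler_wpM2r ?(ltW (t0 i))//; apply: lerXn2r.
  - by rewrite nnegrE sumr_ge0// => j _; exact: ltW.
  - by rewrite nnegrE ltW.
  apply: (@le_trans _ _ (\sum_(j < r) `|B|)); last by rewrite lerDr.
  by apply: ler_sum => j _; exact: le_trans (tB j) (ler_norm _).
Qed.

Lemma gap_values_homeo : exists G : 'rV[R]_r -> 'rV[R]_r,
  [/\ forall w, pos_orthant w -> pos_orthant (G w) /\ gap_values m (G w) = w,
      forall t, pos_orthant t -> G (gap_values m t) = t
    & forall w, pos_orthant w -> G @ w --> G w].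
Proof.
have [dF [FS FP]] := gap_values_slopes R m.
exact: (P_function_homeo gap_values_proper (local_P_function_of_slopes FS FP)).
Qed.

End gap_values_homeo.

(** * Chambers: configurations whose values are in a prescribed order *)

Section chambers.
Variable R : realType.

Definition pattern (k : nat) (v : 'I_k -> R) : {ffun 'I_k * 'I_k -> bool} :=
  [ffun p => v p.1 < v p.2].

Definition chamber (k : nat) (m : 'I_k -> nat) (o : {ffun 'I_k * 'I_k -> bool}) :=
  [set c : 'rV[R]_k | increasing c /\ pattern (root_val m c) = o].

(** The combinatorial side of the count: strict orders compatible with the signs of the derivative
    on the gaps. The multiplicities enter through [gap_sign] only, hence through their parities. *)
Definition realizable (k : nat) (m : 'I_k -> nat) (o : {ffun 'I_k * 'I_k -> bool}) :=
  exists v : 'I_k -> R, [/\ injective v, pattern v = o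
    & forall i j : 'I_k, j = i.+1 :> nat -> 0 < gap_sign R m i * (v j - v i)].

Lemma eq_pattern (k : nat) (v w : 'I_k -> R) :
  (forall i j, v j - v i = w j - w i) -> pattern v = pattern w.
Proof.
by move=> vw; apply/ffunP => -[i j]; rewrite !ffunE /= -subr_gt0 vw subr_gt0.
Qed.

Lemma root_val_shift (k : nat) (m : 'I_k -> nat) (c : 'rV[R]_k) (e : R) (i j : 'I_k) :
  root_val m (c + const_mx e) j - root_val m (c + const_mx e) i =
  root_val m c j - root_val m c i.
Proof.
have pE : root_prod m (c + const_mx e) = root_prod m c \Po ('X - e%:P).
  rewrite /root_prod rmorph_prod/=; apply: eq_bigr => l _.
  by rewrite rmorphXn/= comp_polyB comp_polyX comp_polyC !mxE polyCD opprD addrA addrAC.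
have [b eb] : exists b : R, integ (root_prod m c \Po ('X - e%:P)) =
    (integ (root_prod m c) \Po ('X - e%:P)) + b%:P.
  apply: eq_deriv_cst; rewrite deriv_integ deriv_comp deriv_integ.
  by rewrite derivXsubC mulr1.
rewrite /root_val pE eb !mxE !hornerD !hornerC !horner_comp !hornerXsubC.
by rewrite !addrK opprD addrACA subrr addr0.
Qed.

Lemma connected_by_subsets (T : topologicalType) (A : set T) :
  (forall x y, A x -> A y -> exists B, [/\ B x, B y, B `<=` A & connected B]) ->
  connected A.
Proof.
move=> h; have [->|/set0P[x Ax]] := eqVneq A set0; first exact: connected0.
rewrite (_ : A = connected_component A x); first exact: component_connected.
apply/seteqP; split; last exact: connected_component_sub.
move=> y Ay; have [B [Bx By BA cB]] := h x y Ax Ay.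
exact: (connected_component_max Bx BA cB).
Qed.

Lemma segment_continuous (a b : R) : continuous (fun s : R => (1 - s) * a + s * b).
Proof.
move=> s; apply: (@continuousD _ _ _ (fun s : R => (1 - s) * a) (fun s : R => s * b)).
  apply: (@continuousM _ _ (fun s : R => 1 - s) (fun=> a)); last exact: cst_continuous.
  by apply: (@continuousB _ _ _ (fun=> 1 : R) (@id R)) => //; exact: cst_continuous.
by apply: (@continuousM _ _ (@id R) (fun=> b)) => //; exact: cst_continuous.
Qed.

Section at_least_one_point.
Variables (r : nat) (m : 'I_r.+1 -> nat).
Implicit Types (c : 'rV[R]_r.+1) (d : 'rV[R]_r).

Definition gaps c : 'rV[R]_r := \row_i (c 0 (gap_hi i) - c 0 (gap_lo i)).

(** Recovers the values at the points, relative to the first one, from the gap values. Its linearity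
    in [d] is what makes a chamber convex in these coordinates. *)
Definition signed_sum d (j : 'I_r.+1) : R := psum (\row_i (gap_sign R m i * d 0 i)) j.

Lemma signed_sum_linear (a : R) d d' j :
  signed_sum (a *: d + d') j = a * signed_sum d j + signed_sum d' j.
Proof.
rewrite /signed_sum -psum_linear; congr (psum _ _).
by apply/rowP => i; rewrite !mxE; ring.
Qed.

Lemma psum_telescope (v : 'I_r.+1 -> R) (j : 'I_r.+1) :
  psum (\row_i (v (gap_hi i) - v (gap_lo i))) j = v j - v ord0.
Proof.
case: j => n nr; elim: n nr => [|n IH] nr.
  rewrite /psum big_pred0 => [|i]; last by [].
  by rewrite (_ : Ordinal nr = ord0) ?subrr//; exact: val_inj.
have nr' : (n < r)%N by [].
rewrite /= -[n.+1]/((Ordinal nr').+1) psumS.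
have := IH (ltnW nr) => /= ->; rewrite mxE.
rewrite (_ : gap_hi _ = Ordinal nr); last by apply: val_inj.
rewrite (_ : gap_lo _ = Ordinal (ltnW nr)); last by apply: val_inj.
by ring.
Qed.

Lemma gapsK c : exists e, gap_points m (gaps c) + const_mx e = c.
Proof.
exists (c 0 ord0 + (\sum_l (m l)%:R * psum (gaps c) l) / (\sum_l m l)%:R).
by apply/rowP => j; rewrite !mxE (psum_telescope (c 0)); ring.
Qed.

Lemma gaps_pos c : increasing c -> pos_orthant (gaps c).
Proof. by move=> cinc i; rewrite mxE subr_gt0 cinc. Qed.

Lemma increasing_shift c e : increasing c -> increasing (c + const_mx e).
Proof. by move=> cinc i j ij; rewrite !mxE ltrD2r cinc. Qed.

Lemma signed_sum_gap_values t i j :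
  signed_sum (gap_values m t) j - signed_sum (gap_values m t) i =
  root_val m (gap_points m t) j - root_val m (gap_points m t) i.
Proof.
have h l : signed_sum (gap_values m t) l =
    root_val m (gap_points m t) l - root_val m (gap_points m t) ord0.
  rewrite -(psum_telescope (root_val m (gap_points m t))) /signed_sum.
  congr (psum _ _); apply/rowP => i'; rewrite !mxE.
  by rewrite mulrA gap_sign_sq mul1r.
by rewrite !h; ring.
Qed.

Lemma chamber_nonempty o : realizable m o -> chamber m o !=set0.
Proof.
move=> [v [_ vo vs]].
have [G [GK _ _]] := @gap_values_homeo R r m.
pose d : 'rV[R]_r := \row_i (gap_sign R m i * (v (gap_hi i) - v (gap_lo i))).
have d0 : pos_orthant d by move=> i; rewrite mxE; exact: (vs (gap_lo i) (gap_hi i)).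
have [t0 tE] := GK d d0.
exists (gap_points m (G d)); split; first exact: gap_points_increasing.
rewrite -vo; apply: eq_pattern => i j; rewrite -signed_sum_gap_values tE.
have h l : signed_sum d l = v l - v ord0.
  rewrite -psum_telescope /signed_sum; congr (psum _ _); apply/rowP => i'.
  by rewrite !mxE mulrA gap_sign_sq mul1r.
by rewrite !h; ring.
Qed.

(** Pull back by [G] the segment between two vectors of gap values. Differences of values are linear
    along it, so both the strict comparisons and the weak ones coming from their negations
    persist. *)
Lemma chamber_succ_connected o : connected (chamber m o).
Proof.
have [G [GK KG Gc]] := @gap_values_homeo R r m.
apply: connected_by_subsets => c c' [cinc co] [c'inc c'o].
have [e ce] := gapsK c; have [e' ce'] := gapsK c'.
pose d := gap_values m (gaps c); pose d' := gap_values m (gaps c').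
have d0 : pos_orthant d by move=> i; apply: gap_value_gt0; exact: gaps_pos.
have d'0 : pos_orthant d' by move=> i; apply: gap_value_gt0; exact: gaps_pos.
pose D (s : R) := (1 - s) *: d + s *: d'.
have D0 s : 0 <= s <= 1 -> pos_orthant (D s).
  move=> /andP[s0 s1] i; rewrite [D s 0 i]mxE [X in X + _]mxE [X in _ + X]mxE.
  have [->|sn] := eqVneq s 0; first by rewrite subr0 mul1r mul0r addr0 d0.
  rewrite ltr_wpDl// ?mulr_ge0 ?subr_ge0 ?(ltW (d0 i))//.
  by rewrite mulr_gt0 ?d'0// lt_neqAle eq_sym sn.
(* A chamber is not restricted to centred configurations, so the translation part is interpolated as
   well. *)
pose g (s : R) := gap_points m (G (D s)) + const_mx ((1 - s) * e + s * e').
have gc : {within `[0, 1], continuous g}.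
  apply: continuous_in_subspaceT => s; rewrite inE/= in_itv/= => s01.
  apply: (@continuousD _ _ _ (fun s : R => gap_points m (G (D s)))
    (fun s : R => const_mx ((1 - s) * e + s * e'))).
    apply: (@continuous_comp _ _ _ _ (gap_points m)); last exact: gap_points_continuous.
    apply: (@continuous_comp _ _ _ D G); last exact: Gc (D0 s s01).
    apply: cvg_row => i; rewrite (_ : (fun _ => _) =
      fun s => (1 - s) * d 0 i + s * d' 0 i); last first.
      by apply/funext => x; rewrite [LHS]mxE [X in X + _]mxE [X in _ + X]mxE.
    by rewrite [D s 0 i]mxE [X in X + _]mxE [X in _ + X]mxE; exact: segment_continuous.
  apply: cvg_row => i; rewrite mxE; under eq_fun do rewrite mxE.
  exact: segment_continuous.
exists (g @` `[0, 1]%classic); split.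
- exists 0; first by rewrite /= in_itv/= lexx ler01.
  by rewrite /g /D subr0 scale1r scale0r addr0 KG ?mul1r ?mul0r ?addr0//; exact: gaps_pos.
- exists 1; first by rewrite /= in_itv/= lexx ler01.
  by rewrite /g /D subrr scale1r scale0r add0r KG ?mul1r ?mul0r ?add0r//; exact: gaps_pos.
- move=> _ [s /= + <-]; rewrite in_itv/= => s01; have [Gs0 GsE] := GK _ (D0 s s01).
  split; first by apply: increasing_shift; exact: gap_points_increasing.
  apply/ffunP => -[i j]; rewrite ffunE/= -subr_gt0 root_val_shift.
  rewrite -signed_sum_gap_values GsE.
  have oc : (0 < signed_sum d j - signed_sum d i) = o (i, j).
    by rewrite signed_sum_gap_values -(root_val_shift _ _ e) ce -co ffunE subr_gt0.
  have oc' : (0 < signed_sum d' j - signed_sum d' i) = o (i, j).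
    by rewrite signed_sum_gap_values -(root_val_shift _ _ e') ce' -c'o ffunE subr_gt0.
  have DE l : signed_sum (D s) l = (1 - s) * signed_sum d l + s * signed_sum d' l.
    by rewrite signed_sum_linear -[s *: d']addr0 signed_sum_linear
      (_ : signed_sum 0 l = 0) ?addr0// /signed_sum /psum big1// => i' _; rewrite !mxE mulr0.
  rewrite !DE; set x := signed_sum d j - signed_sum d i in oc.
  set x' := signed_sum d' j - signed_sum d' i in oc'.
  rewrite (_ : _ - _ = (1 - s) * x + s * x'); last by rewrite /x /x'; ring.
  clearbody x x'.
  have /andP[s0 s1] := s01.
  case: (o (i, j)) oc oc' => h h'.
    have [->|sn] := eqVneq s 0; first by rewrite subr0 mul1r mul0r addr0.
    rewrite ltr_wpDl// ?mulr_ge0 ?subr_ge0 ?(ltW h)//.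
    by rewrite mulr_gt0// lt_neqAle eq_sym sn.
  apply/negbTE; rewrite -leNgt; move/negbT: h; move/negbT: h'; rewrite -!leNgt => h' h.
  by rewrite -oppr_ge0 opprD -!mulrN addr_ge0// mulr_ge0 ?subr_ge0 ?oppr_ge0.
- by apply: connected_continuous_connected => //; exact: segment_connected.
Qed.

End at_least_one_point.

Theorem chamber_connected (k : nat) (m : 'I_k -> nat) o : realizable m o ->
  chamber m o !=set0 /\ connected (chamber m o).
Proof.
case: k m o => [|r] m o ro; last first.
  by split; [exact: chamber_nonempty|exact: chamber_succ_connected].
have -> : chamber m o = [set 0].
  apply/seteqP; split=> [c _|c _ /=]; first by apply/rowP => -[].
  by split; [move=> []|apply/ffunP => -[[]]].
by split; [exists 0|exact: connected1].
Qed.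

Lemma chamber_realizable (k : nat) (m : 'I_k -> nat) (c : 'rV[R]_k) :
  increasing c -> injective (root_val m c) -> realizable m (pattern (root_val m c)).
Proof.
case: k m c => [|r] m c cinc vinj.
  by exists (fun _ => 0); split=> [[]|| []]//; apply/ffunP => -[[]].
exists (root_val m c); split => // _ _ /gap_loP[i [-> ->]].
have [e ce] := gapsK m c.
rewrite -ce root_val_shift.
have := @gap_value_gt0 R r m _ i (gaps_pos cinc); rewrite mxE.
by [].
Qed.

Lemma eq_realizable (k : nat) (m m' : 'I_k -> nat) o :
  (forall j, odd (m j) = odd (m' j)) -> realizable m o -> realizable m' o.
Proof.
move=> mm' [v [vi vo vs]]; exists v; split => // i j ij.
rewrite (_ : gap_sign R m' i = gap_sign R m i) ?vs//.
apply: eq_bigr => l _; case: ifP => _; first by rewrite !expr1n.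
by rewrite -signr_odd -mm' signr_odd.
Qed.

End chambers.

(** * Counting components *)

Section counting_components.
Variable T : topologicalType.

Lemma finite_union_closure (I : finType) (P : pred I) (B : I -> set T) (x : T) :
  (forall i, P i -> ~ closure (B i) x) -> ~ closure (\bigcup_(i in [set` P]) B i) x.
Proof.
move=> nB; have h i : exists2 N, nbhs x N & P i -> B i `&` N = set0.
  have [Pi|nPi] := boolP (P i); last by exists setT => //; exact: filterT.
  have /existsNP[N /not_implyP[nN /set0P/negP/negPn/eqP BN]] := nB i Pi.
  by exists N.
have [N nN BN] : exists2 N : I -> set T, (forall i, nbhs x (N i)) &
    forall i, P i -> B i `&` N i = set0.
  have [N HN] := choice (fun i => let: ex_intro2 N h1 h2 := h i in
    ex_intro (fun N => nbhs x N /\ (P i -> B i `&` N = set0)) N (conj h1 h2)).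
  by exists N => i; have [] := HN i.
have nI : \forall y \near x, forall i, N i y by apply: filter_forall.
move=> /(_ _ nI)[y [[i /= Pi Biy] Ny]].
by have : (B i `&` N i) y by []; rewrite BN.
Qed.

(** A finite union of relatively closed pieces is relatively closed, so each piece is separated from
    the union of the others. A connected set meeting a piece therefore stays in it; nonemptiness
    makes distinct indices give distinct components. *)
Theorem components_partition (I : finType) (D : {set I}) (B : I -> set T) (A : set T) :
  A = \bigcup_(i in [set` D]) B i ->
  {in D, forall i, B i !=set0 /\ connected (B i)} ->
  {in D &, forall i j, B i `&` B j !=set0 -> i = j} ->
  {in D, forall i, A `&` closure (B i) `<=` B i} ->
  finite_set (components A) /\ nb_components A = #|D|.
Proof.
move=> AE Bc Bdisj Bcl.
have BA i : i \in D -> B i `<=` A by move=> iD x Bx; rewrite AE; exists i.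
have compE i x : i \in D -> B i x -> connected_component A x = B i.
  move=> iD Bx; apply/seteqP; split; last first.
    by apply: connected_component_max => //; [exact: BA|exact: (Bc i iD).2].
  set P := [pred j | (j \in D) && (j != i)].
  pose C := \bigcup_(j in [set` P]) B j.
  have CA : C `<=` A by move=> y [j /= /andP[jD _]]; exact: BA.
  have BiC0 : B i `&` C = set0.
    apply/eqP; apply: contraT => /set0P[y [Biy [j /= /andP[jD ji] Bjy]]].
    by move/eqP: ji; case; apply: Bdisj => //; exists y.
  have sep : separated (B i) C.
    split.
      apply/seteqP; split=> // y [cy Cy]; rewrite -BiC0; split=> //.
      by apply: Bcl => //; split => //; exact: CA.
    apply/seteqP; split=> // y [Biy]; apply: finite_union_closure => j /andP[jD ji] cy.
    have Bjy : B j y by apply: Bcl => //; split => //; exact: BA Biy.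
    by move/eqP: ji; case; apply: Bdisj => //; exists y.
  have : connected_component A x `<=` B i `|` C.
    move=> y /connected_component_sub; rewrite AE => -[j /= jD Bjy].
    by have [<-|ji] := eqVneq j i; [left|right; exists j => //=; apply/andP].
  move/(connected_subset sep) => /(_ (component_connected (x := x)))[//|xC].
  have : C x by apply: xC; apply: connected_component_refl; exact: BA Bx.
  by move=> Cx; have : (B i `&` C) x by []; rewrite BiC0.
pose F := [fset X in [seq B i | i <- enum D]]%fset.
have compF : components A = [set` F].
  apply/seteqP; split=> [_ [x Ax <-]|X /=].
    move: (Ax); rewrite AE => -[i iD Bx]; rewrite -AE (compE i)//= in_fset/=.
    by apply/mapP; exists i; rewrite ?mem_enum.
  rewrite in_fset/= => /mapP[i iD ->]; rewrite mem_enum in iD.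
  by have [[x Bx] _] := Bc i iD; exists x; [exact: BA Bx|exact: compE].
rewrite /nb_components compF; split; first exact: finite_fset.
rewrite set_fsetK card_fseq undup_id ?size_map -?cardE//.
rewrite map_inj_in_uniq ?enum_uniq// => i j; rewrite !mem_enum => iD jD Bij.
by apply: Bdisj => //; have [[x Bx] _] := Bc i iD; exists x; rewrite -Bij.
Qed.

End counting_components.

(** * A decomposition theorem common to both spaces *)

Section chamber_decomposition.
Variables (R : realType) (k : nat).
Implicit Types (m : 'I_k -> nat) (c : 'rV[R]_k).

Definition centered m c := \sum_j (m j)%:R * c 0 j = 0.

(* Nothing moves when [m = 0], since then the shift is [0 / 0 = 0]. *)
Definition recenter m c := c + const_mx (- ((\sum_j (m j)%:R * c 0 j) / (\sum_j m j)%:R)).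

Definition weakly_increasing c := forall i j : 'I_k, (i <= j)%N -> c 0 i <= c 0 j.

Lemma recenter_centered m c : centered m (recenter m c).
Proof.
have [M0|M0] := eqVneq (\sum_j m j)%N 0%N.
  rewrite /centered big1// => j _; move/eqP: M0; rewrite sum_nat_eq0 => /forallP/(_ j).
  by move=> /eqP ->; rewrite mul0r.
rewrite /centered; pose e : R := (\sum_j (m j)%:R * c 0 j) / (\sum_j m j)%:R.
rewrite (eq_bigr (fun j => (m j)%:R * c 0 j - (m j)%:R * e)); last first.
  by move=> j _; rewrite !mxE mulrDr mulrN.
by rewrite sumrB -mulr_suml -natr_sum mulrC /e divfK ?subrr// pnatr_eq0.
Qed.

Lemma recenter_id m c : centered m c -> recenter m c = c.
Proof. by rewrite /recenter => ->; apply/rowP => j; rewrite !mxE mul0r oppr0 addr0. Qed.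

Lemma recenter_increasing m c : increasing c -> increasing (recenter m c).
Proof. by move=> cinc i j ij; rewrite !mxE ltrD2r cinc. Qed.

Lemma recenter_pattern m m' c :
  pattern (root_val m (recenter m' c)) = pattern (root_val m c).
Proof. by apply: eq_pattern => i j; rewrite root_val_shift. Qed.

Lemma recenter_val_inj m m' c : injective (root_val m c) ->
  injective (root_val m (recenter m' c)).
Proof.
move=> vinj i j /eqP; rewrite -subr_eq0 root_val_shift subr_eq0 => /eqP; exact: vinj.
Qed.

Lemma root_val_continuous m j : continuous (fun c => root_val m c j).
Proof.
have [dp [_ /(_ j)[]]] := @has_slopes_root_val R k k id m (fun x => cvg_id)
  (fun _ _ => erefl) (fun _ _ => erefl).
by [].
Qed.

Lemma coef_root_prod_continuous m i : continuous (fun c => (root_prod m c)`_i).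
Proof.
have [dp [/(_ i)[]]] := @poly_slopes_root_prod R k k id m (fun x => cvg_id)
  (fun _ _ => erefl) (fun _ _ => erefl).
by [].
Qed.

Lemma closed_forall_ge0 (T : topologicalType) (I : Type) (f : I -> T -> R) :
  (forall i, continuous (f i)) -> closed [set x | forall i, 0 <= f i x].
Proof.
move=> fc; rewrite (_ : [set _ | _] = \bigcap_i [set x | 0 <= f i x]); last first.
  by apply/seteqP; split=> x //= h i; [move=> _; exact: h|exact: h].
apply: closed_bigI => i _; rewrite (_ : [set _ | _] = f i @^-1` [set y | y >= 0])//.
by apply: closed_comp; [move=> x _; exact: fc|exact: closed_ge].
Qed.

Lemma pattern_inj (v w : 'I_k -> R) : pattern v = pattern w -> injective v -> injective w.
Proof.
move=> /ffunP vw vi i j wij; apply: vi; apply/eqP; rewrite eq_le !leNgt.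
have := vw (i, j); have := vw (j, i); rewrite !ffunE /= => -> ->.
by rewrite wij ltxx.
Qed.

(** [e] is the discrete datum telling which points carry which multiplicity, and [Th e] sends a
    configuration to the space. [Th_rigid] says that a degenerate configuration never lands in [A];
    [Th_proper] keeps the centred preimages bounded near any point, including points outside [A]. *)
Variables (T : topologicalType) (E : finType) (D : {set E}) (m : E -> 'I_k -> nat).
Variables (Th : E -> 'rV[R]_k -> T) (A : set T).
Hypotheses (T_hausdorff : hausdorff_space T)
  (Th_cont : {in D, forall e, continuous (Th e)})
  (Th_center : forall e c, Th e (recenter (m e) c) = Th e c)
  (Th_cover : forall x, A x -> exists2 e, e \in D &
     exists c, [/\ increasing c, injective (root_val (m e) c) & Th e c = x])
  (Th_land : {in D, forall e c, increasing c -> injective (root_val (m e) c) -> A (Th e c)})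
  (Th_rigid : {in D, forall e c, weakly_increasing c -> centered (m e) c -> A (Th e c) ->
     increasing c /\ injective (root_val (m e) c)})
  (Th_inj : {in D &, forall e e' c c', increasing c -> increasing c' ->
     centered (m e) c -> centered (m e') c' -> Th e c = Th e' c' -> e = e' /\ c = c'})
  (Th_proper : forall x : T, exists b : R, nbhs x [set y |
     {in D, forall e c, centered (m e) c -> Th e c = y -> forall j, `|c 0 j| <= b}]).

Let piece (eo : E * {ffun 'I_k * 'I_k -> bool}) := Th eo.1 @` chamber (m eo.1) eo.2.

(* In a limit of configurations of a piece points and values can only collide, and
   [Th_rigid] excludes collisions inside [A]. *)
Lemma piece_closed (e : E) (v : 'I_k -> R) : e \in D -> injective v ->
  A `&` closure (piece (e, pattern v)) `<=` piece (e, pattern v).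
Proof.
move=> eD vinj x [Ax clx]; set o := pattern v in clx *.
have [b nb] := Th_proper x.
pose f (ij : 'I_k * 'I_k) c := if (ij.1 <= ij.2)%N then c 0 ij.2 - c 0 ij.1 else 0.
pose g (ij : 'I_k * 'I_k) c :=
  if o ij then root_val (m e) c ij.2 - root_val (m e) c ij.1 else 0.
pose h c : R := \sum_j (m e j)%:R * c 0 j.
(* Bounded centred configurations satisfying the weak forms of all order conditions; this set is
   compact, so its image is closed and contains the limit [x]. *)
pose L := [set c : 'rV[R]_k | forall j, `[- b, b]%classic (c 0 j)] `&`
  ([set c | forall ij, 0 <= f ij c] `&` ([set c | forall ij, 0 <= g ij c] `&`
   h @^-1` [set 0])).
have cL : compact L.
  apply: (@subclosed_compact _ _ [set c : 'rV[R]_k | forall j, `[- b, b]%classic (c 0 j)]).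
  - apply: closedI.
      apply: compact_closed; first exact: norm_hausdorff.
      by apply: (@rV_compact _ _ (fun=> `[- b, b]%classic)) => _; exact: segment_compact.
    apply: closedI; last apply: closedI.
    + apply: closed_forall_ge0 => -[i j]; rewrite /f /=.
      case: (i <= j)%N; last exact: cst_continuous.
      by move=> c; apply: (@continuousB _ _ _ (fun c : 'rV[R]_k => c 0 j)
        (fun c : 'rV[R]_k => c 0 i)); exact: coord_continuous.
    + apply: closed_forall_ge0 => -[i j]; rewrite /g /=.
      case: (o (i, j)); last exact: cst_continuous.
      by move=> c; apply: (@continuousB _ _ _ (fun c => root_val (m e) c j)
        (fun c => root_val (m e) c i)); exact: root_val_continuous.
    + apply: closed_comp; last exact: closed_eq.
      move=> c _; apply: continuous_sum => j {}c.
      apply: (@continuousM _ _ (fun=> (m e j)%:R) (fun c : 'rV[R]_k => c 0 j)).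
        exact: cst_continuous.
      exact: coord_continuous.
  - by apply: (@rV_compact _ _ (fun=> `[- b, b]%classic)) => _; exact: segment_compact.
  - by move=> c [].
have clL : closed (Th e @` L).
  apply: compact_closed => //; apply: continuous_compact => //.
  by apply: continuous_subspaceT; exact: Th_cont.
have : (Th e @` L) x.
  apply: clL => N nN.
  (* Representatives in the chamber need not be centred; recentring keeps image and pattern and
     makes the local bound applicable. *)
  have [y [[c [cinc co] <-] [Ny yb]]] := clx _ (filterI nN nb).
  exists (Th e c); split => //; exists (recenter (m e) c); last exact: Th_center.
  have {}co : pattern (root_val (m e) c) = o := co.
  have cb := yb e eD _ (recenter_centered (m e) c) (Th_center e c).
  split; first by move=> j; rewrite /= in_itv/= -ler_norml.
  split.
    move=> [i j]; rewrite /f /=; case: leqP => // ij.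
    by rewrite subr_ge0 increasing_mono_le//; exact: recenter_increasing.
  split; last exact: recenter_centered.
  move=> [i j]; rewrite /g /= -co -(recenter_pattern _ (m e)) ffunE /=.
  by case: ltP => // /ltW; rewrite subr_ge0.
move=> [c [_ [cf [cg ch]]] cx].
have cnd : weakly_increasing c.
  by move=> i j ij; have := cf (i, j); rewrite /f /= ij subr_ge0.
have Ac : A (Th e c) by rewrite cx.
have [cinc ci] := Th_rigid eD cnd ch Ac.
exists c => //; split=> //; apply/ffunP => -[i j]; rewrite ffunE /=.
have [->|ij] := eqVneq i j; first by rewrite ltxx /o ffunE /= ltxx.
have /eqP vij : root_val (m e) c i <> root_val (m e) c j by move/ci/eqP; apply/negP.
case oij : (o (i, j)).
  have := cg (i, j); rewrite /g oij subr_ge0 /= => h1.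
  by rewrite lt_neqAle vij.
(* Injectivity of [v] makes the order total, so a failed comparison gives the reverse one, which
   passes to the limit. *)
have oji : o (j, i).
  move: oij; rewrite !ffunE /= => /negbT; rewrite -leNgt => vji.
  by rewrite lt_neqAle vji andbT; apply: contra ij => /eqP/vinj ->.
by have := cg (j, i); rewrite /g oji subr_ge0 /= => h1; apply/negbTE; rewrite -leNgt.
Qed.

Definition chamber_types :=
  [set eo : E * {ffun 'I_k * 'I_k -> bool} | (eo.1 \in D) && `[< realizable R (m eo.1) eo.2 >]]%SET.

Theorem chamber_decomposition :
  finite_set (components A) /\ nb_components A = #|chamber_types|.
Proof.
apply: (@components_partition _ _ chamber_types piece A).
- apply/seteqP; split=> [x Ax|x [[e o] /=]].
    have [e eD [c [cinc ci <-]]] := Th_cover Ax.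
    exists (e, pattern (root_val (m e) c)); last by exists c.
    by rewrite /= inE eD; apply/asboolP; exact: chamber_realizable.
  rewrite inE /= => /andP[eD /asboolP[v [vi vo _]]] [c [cinc co] <-].
  by apply: Th_land => //; apply: pattern_inj vi; rewrite vo co.
- move=> [e o]; rewrite inE /= => /andP[eD /asboolP ro].
  have [[c cc] cco] := chamber_connected ro; split; first by exists (Th e c); exists c.
  by apply: connected_continuous_connected => //; exact/continuous_subspaceT/Th_cont.
- move=> [e o] [e' o']; rewrite !inE /= => /andP[eD _] /andP[e'D _].
  move=> [_ [[c [cinc co] <-] [c' [c'inc c'o] ec]]].
  rewrite /= in co c'o ec.
  have [|||||ee cc] := Th_inj eD e'D (c := recenter (m e) c) (c' := recenter (m e') c').
  + exact: recenter_increasing.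
  + exact: recenter_increasing.
  + exact: recenter_centered.
  + exact: recenter_centered.
  + by rewrite !Th_center.
  by rewrite -co -c'o -(recenter_pattern _ (m e)) cc ee recenter_pattern.
- move=> [e o]; rewrite inE /= => /andP[eD /asboolP[v [vi <- _]]].
  exact: piece_closed.
Qed.

End chamber_decomposition.

(** * The two spaces *)

Section polynomials_from_critical_points.
Variable R : realType.

Section roots.
Variable k : nat.
Implicit Types (m : 'I_k -> nat) (c : 'rV[R]_k).

Definition roots_seq m c : seq R :=
  flatten [seq nseq (m j) (c 0 j) | j <- index_enum 'I_k].

Lemma root_prod_seq m c : root_prod m c = \prod_(x <- roots_seq m c) ('X - x%:P).
Proof.
rewrite /roots_seq big_flatten big_map; apply: eq_bigr => j _.
by rewrite big_nseq -Monoid.iteropE.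
Qed.

Lemma size_roots_seq m c : size (roots_seq m c) = (\sum_j m j)%N.
Proof.
have := size_root_prod m c; rewrite root_prod_seq size_prod_XsubC => -[->].
by [].
Qed.

Lemma sum_roots_seq m c : \sum_(x <- roots_seq m c) x = \sum_j (m j)%:R * c 0 j.
Proof.
rewrite /roots_seq big_flatten big_map; apply: eq_bigr => j _.
by rewrite big_nseq iter_addr_0 mulr_natl.
Qed.

Lemma root_prod_subleading m c : (0 < \sum_j m j)%N ->
  (root_prod m c)`_(\sum_j m j).-1 = - \sum_j (m j)%:R * c 0 j.
Proof.
move=> m0; rewrite -sum_roots_seq -coefPn_prod_XsubC ?size_roots_seq -?lt0n//.
by rewrite root_prod_seq.
Qed.

Lemma mup_root_prod m c (i : 'I_k) : injective (c 0) -> mup (c 0 i) (root_prod m c) = m i.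
Proof.
move=> cinj; rewrite root_prod_seq mu_prod_XsubC /roots_seq count_flatten -map_comp.
rewrite sumnE big_map (bigD1 i)//= big1 ?addn0; last first.
  by move=> j ji; rewrite count_nseq /= (inj_eq cinj) (negbTE ji).
by rewrite count_nseq /= eqxx mul1n.
Qed.

Lemma root_root_prod m c x :
  root (root_prod m c) x = [exists j, (0 < m j)%N && (x == c 0 j)].
Proof.
rewrite root_prod_seq root_prod_XsubC; apply/flatten_mapP/existsP => [[j _]|[j /andP[mj xj]]].
  by rewrite mem_nseq => h; exists j.
by exists j; rewrite ?mem_index_enum// mem_nseq mj.
Qed.

Lemma eq_increasing c c' : increasing c -> increasing c' ->
  [seq c 0 j | j <- enum 'I_k] =i [seq c' 0 j | j <- enum 'I_k] -> c = c'.
Proof.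
have srt (d : 'rV[R]_k) : increasing d -> sorted <%R [seq d 0 j | j <- enum 'I_k].
  move=> dinc; rewrite sorted_map; have := iota_ltn_sorted 0 k.
  rewrite -val_enum_ord sorted_map; apply: sub_sorted => i j; exact: dinc.
move=> /srt cs /srt c's /(lt_sorted_eq cs c's) cc.
apply/rowP => j; have := congr1 (fun s => nth 0 s j) cc.
by do 2 rewrite (nth_map j) ?size_enum_ord// nth_ord_enum.
Qed.

Lemma weakly_increasing_inj_increasing c :
  weakly_increasing c -> injective (c 0) -> increasing c.
Proof.
move=> cnd cinj i j ij; rewrite lt_neqAle cnd 1?ltnW// andbT.
by apply: contraTneq ij => /cinj ->; rewrite ltnn.
Qed.

Lemma root_prod_dvd m c p : injective (c 0) ->
  (forall j, ('X - (c 0 j)%:P) ^+ m j %| p) -> root_prod m c %| p.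
Proof.
move=> cinj cp; rewrite /root_prod.
have := index_enum_uniq 'I_k; elim: (index_enum _) => [|j s IH] /=.
  by rewrite big_nil dvd1p.
move=> /andP[js us]; rewrite big_cons Gauss_dvdp ?cp ?IH//.
rewrite coprimep_sym; apply: coprimep_expr; rewrite coprimep_XsubC.
elim: s js {us IH} => [|i s IH]; first by rewrite big_nil root1.
rewrite in_cons negb_or big_cons rootM negb_or => /andP[ji /IH ->]; rewrite andbT.
case: (m i) => [|mi]; first by rewrite expr0 root1.
by rewrite root_exp_XsubC; apply: contra ji => /eqP/cinj ->.
Qed.

End roots.

Lemma PpolyE (N : nat) (a : Pspace R N) (i : nat) : (Ppoly a)`_i =
  (i == N)%:R + \sum_(j < N - 2) a 0 j * (i == N - 2 - j)%N%:R.
Proof.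
by rewrite coefD coefXn coef_sum; congr (_ + _); apply: eq_bigr => j _; rewrite coefZ coefXn.
Qed.

Lemma coef_Ppoly_mid (N : nat) (a : Pspace R N) (i : 'I_(N - 2)) :
  (Ppoly a)`_(N - 2 - i) = a 0 i.
Proof.
have iN := ltn_ord i.
rewrite PpolyE (_ : (_ == N) = false) ?add0r; last first.
  by apply/negbTE; rewrite neq_ltn; apply/orP; left; lia.
rewrite (bigD1 i)//= eqxx mulr1 big1 ?addr0// => j ji.
rewrite (_ : (_ == _) = false) ?mulr0//; apply/negbTE; apply: contra ji => /eqP h.
by apply/eqP/val_inj => /=; have := ltn_ord j; lia.
Qed.

Lemma coef_Ppoly_out (N i : nat) (a : Pspace R N) :
  (i == 0)%N || (N - 2 < i)%N -> (Ppoly a)`_i = (i == N)%:R.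
Proof.
move=> h; rewrite PpolyE big1 ?addr0// => j _.
rewrite (_ : (_ == _) = false) ?mulr0//; apply/negbTE; have jN := ltn_ord j.
by apply/eqP => e; move: h; rewrite e; case/orP; lia.
Qed.

Lemma Ppoly_inj (N : nat) : injective (@Ppoly R N).
Proof. by move=> a b ab; apply/rowP => i; rewrite -!coef_Ppoly_mid ab. Qed.

Section critical_row.
Variables (k N : nat) (m : 'I_k -> nat).
Hypothesis mN : (\sum_j m j).+1 = N.
Implicit Types c : 'rV[R]_k.

(** Recentring inside the definition makes the map total: for every [c] the antiderivative, scaled
    by [N], is monic, without constant term and without a term of degree [N - 1] when [N > 1]. *)
Definition critical_row c : Pspace R N :=
  \row_i (N%:R * (integ (root_prod m (recenter m c)))`_(N - 2 - i)).

Lemma Ppoly_critical_row c :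
  Ppoly (critical_row c) = N%:R *: integ (root_prod m (recenter m c)).
Proof.
set d := recenter m c; have dc : centered m d := recenter_centered m c.
have N0 : N%:R != 0 :> R by rewrite -mN pnatr_eq0.
apply/polyP => i; rewrite coefZ.
have [i0|/norP[i0 iN]] := boolP ((i == 0)%N || (N - 2 < i)%N); last first.
  have iN' : (N - 2 - i < N - 2)%N by lia.
  rewrite (_ : i = N - 2 - Ordinal iN')%N; last by rewrite /=; lia.
  by rewrite coef_Ppoly_mid mxE.
rewrite coef_Ppoly_out//; case/orP: i0 => [/eqP ->|iN].
  by rewrite coef_integ invr0 !mulr0 -mN.
rewrite coef_integ.
have [->|iN'] := eqVneq i N.
  have /monicP := monic_root_prod m d; rewrite lead_coefE size_root_prod -mN /= => ->.
  by rewrite mN mul1r divff.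
have [Ni|iN''] := ltnP N i.
  by rewrite nth_default ?mul0r ?mulr0// size_root_prod mN -ltnS prednK// (leq_ltn_trans _ Ni).
have iE : i = N.-1 by lia.
have [M0|M0] := posnP (\sum_j m j)%N.
  by rewrite iE -mN M0 /= invr0 !mulr0.
rewrite (_ : i.-1 = (\sum_j m j).-1)%N; last by rewrite iE -mN.
by rewrite root_prod_subleading// dc oppr0 mul0r mulr0.
Qed.

Lemma deriv_Ppoly_critical_row c :
  (Ppoly (critical_row c))^`() = N%:R *: root_prod m (recenter m c).
Proof. by rewrite Ppoly_critical_row derivZ deriv_integ. Qed.

(** The missing coefficient of degree [N - 1] forces the roots of the derivative to be centred, and
    the missing constant term fixes the antiderivative. *)
Lemma critical_rowP (a : Pspace R N) c : (Ppoly a)^`() = N%:R *: root_prod m c ->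
  centered m c /\ critical_row c = a.
Proof.
move=> ac; have N0 : N%:R != 0 :> R by rewrite -mN pnatr_eq0.
have cc : centered m c.
  have [M0|M0] := posnP (\sum_j m j)%N.
    rewrite /centered big1// => j _; move/eqP: M0; rewrite sum_nat_eq0 => /forallP/(_ j).
    by move=> /eqP ->; rewrite mul0r.
  have := congr1 (fun p : {poly R} => p`_(\sum_j m j).-1) ac.
  rewrite coefZ root_prod_subleading// coef_deriv prednK// coef_Ppoly_out; last first.
    by apply/orP; right; rewrite -mN; lia.
  rewrite -mN ltn_eqF// mul0rn => /esym/eqP.
  by rewrite mulf_eq0 mN (negbTE N0) oppr_eq0 => /eqP.
split=> //; apply: Ppoly_inj; rewrite Ppoly_critical_row recenter_id//.
have a0 : (Ppoly a)`_0 = 0 by rewrite coef_Ppoly_out// -mN.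
rewrite (integ_unique (p := N%:R *: root_prod m c) ac a0).
by apply: integ_unique; rewrite ?derivZ ?deriv_integ// coefZ coef_integ invr0 !mulr0.
Qed.

Lemma critical_row_recenter c : critical_row (recenter m c) = critical_row c.
Proof. by apply/rowP => i; rewrite !mxE (recenter_id (recenter_centered m c)). Qed.

Lemma M_domain_critical_row c : M_domain (critical_row c).
Proof.
move=> z; rewrite deriv_Ppoly_critical_row root_prod_seq map_polyZ rmorph_nat/=.
rewrite rootZ ?pnatr_eq0 -?mN// rmorph_prod/=.
rewrite (eq_bigr (fun x => 'X - ((real_complex R x)%:P))); last first.
  by move=> x _; rewrite map_polyXsubC.
rewrite -(big_map (real_complex R) xpredT (fun x => 'X - x%:P)) root_prod_XsubC.
by move=> /mapP[x _ ->].
Qed.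

Lemma recenter_continuous : continuous (recenter m : 'rV[R]_k -> _).
Proof.
apply: continuous_row => j; rewrite (_ : (fun _ => _) = fun c : 'rV[R]_k =>
    c 0 j - (\sum_j (m j)%:R * c 0 j) / (\sum_j m j)%:R); last first.
  by apply/funext => c; rewrite !mxE.
move=> c; apply: (@continuousB _ _ _ (fun c : 'rV[R]_k => c 0 j)
  (fun c : 'rV[R]_k => (\sum_j (m j)%:R * c 0 j) / (\sum_j m j)%:R)).
  exact: coord_continuous.
apply: (@continuousM _ _ (fun c : 'rV[R]_k => \sum_j (m j)%:R * c 0 j));
  last exact: cst_continuous.
apply: continuous_sum => i {}c.
apply: (@continuousM _ _ (fun=> (m i)%:R) (fun c : 'rV[R]_k => c 0 i)).
  exact: cst_continuous.
exact: coord_continuous.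
Qed.

Lemma critical_row_continuous : continuous critical_row.
Proof.
apply: continuous_row => i; rewrite (_ : (fun _ => _) = fun c =>
    N%:R * ((root_prod m (recenter m c))`_(N - 2 - i).-1 / (N - 2 - i)%N%:R)); last first.
  by apply/funext => c; rewrite mxE coef_integ.
move=> c; apply: (@continuousM _ _ (fun=> N%:R) (fun c =>
  (root_prod m (recenter m c))`_(N - 2 - i).-1 / (N - 2 - i)%N%:R)).
  exact: cst_continuous.
apply: (@continuousM _ _ (fun c => (root_prod m (recenter m c))`_(N - 2 - i).-1));
  last exact: cst_continuous.
apply: (@continuous_comp _ _ _ (recenter m) (fun c => (root_prod m c)`_(N - 2 - i).-1)).
  exact: recenter_continuous.
exact: coef_root_prod_continuous.
Qed.

(** Cauchy's bound for the roots of the derivative, whose leading coefficient is [N] and whose other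
    coefficients vary continuously. It controls only the points of positive multiplicity. *)
Lemma critical_points_locally_bounded (a : Pspace R N) :
  exists b : R, nbhs a [set a' | forall c j, centered m c -> critical_row c = a' ->
    (0 < m j)%N -> `|c 0 j| <= b].
Proof.
pose h (a : Pspace R N) : R := \sum_(i < N) `|((Ppoly a)^`())`_i|.
have hc : continuous h.
  apply: continuous_sum => i {}a.
  apply: (@continuous_comp _ _ _ (fun a : Pspace R N => ((Ppoly a)^`())`_i) (fun x => `|x|));
    last exact: norm_continuous.
  rewrite (_ : (fun _ => _) = fun a : Pspace R N => i.+1%:R * ((i.+1 == N)%:R +
      \sum_(j < N - 2) a 0 j * (i.+1 == N - 2 - j)%N%:R)); last first.
    by apply/funext => a'; rewrite coef_deriv PpolyE -[_ *+ _]mulr_natl.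
  apply: (@continuousM _ _ (fun=> i.+1%:R)); first exact: cst_continuous.
  apply: (@continuousD _ _ _ (fun=> (i.+1 == N)%:R : R)
    (fun a : Pspace R N => \sum_(j < N - 2) a 0 j * (i.+1 == N - 2 - j)%N%:R)).
    exact: cst_continuous.
  apply: continuous_sum => j {}a.
  apply: (@continuousM _ _ (fun a : Pspace R N => a 0 j)); last exact: cst_continuous.
  exact: coord_continuous.
(* Cauchy's bound with [h a] enlarged by 1, a margin valid on a neighbourhood of [a]. *)
exists (1 + N%:R^-1 * (h a + 1)).
have ha1 : h a < h a + 1 by rewrite ltrDl.
have nh : nbhs a [set a' : Pspace R N | h a' < h a + 1] := hc a _ (lt_nbhsl ha1).
apply: filterS nh => a' /= ha c j cc ca mj.
have N0 : (0 < N)%N by rewrite -mN.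
have dE : (Ppoly a')^`() = N%:R *: root_prod m c.
  by rewrite -ca deriv_Ppoly_critical_row recenter_id.
have szd : size (Ppoly a')^`() = N.
  by rewrite dE size_scale ?pnatr_eq0 -?lt0n// size_root_prod.
have d0 : (Ppoly a')^`() != 0 by rewrite -size_poly_eq0 szd -lt0n.
apply: ltW; apply: (lt_le_trans (cauchy_boundP d0 (_ : _.[c 0 j] = 0))).
  apply/eqP; rewrite -/(root _ _) dE rootZ ?pnatr_eq0 -?lt0n// root_root_prod.
  by apply/existsP; exists j; rewrite mj eqxx.
rewrite /cauchy_bound lerD2l szd dE lead_coefZ (monicP (monic_root_prod m c)) mulr1.
rewrite normr_nat ler_wpM2l ?invr_ge0 ?ler0n// -dE.
exact: ltW.
Qed.

End critical_row.

End polynomials_from_critical_points.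

Local Open Scope card_scope.

Lemma set_of_seq_card (T : choiceType) (A : set T) (s : seq T) :
  uniq s -> (forall x, x \in s <-> A x) -> A #= `I_(size s).
Proof.
move=> us sA; have -> : A = [set` [fset x in s]%fset].
  by apply/seteqP; split=> x /=; rewrite in_fset/= => /sA.
have -> : size s = #|` [fset x in s]%fset| by rewrite card_fseq undup_id.
by apply/card_eq_fsetP.
Qed.

Lemma seq_of_card (T : choiceType) (A : set T) (n : nat) : A #= `I_n ->
  exists s : seq T, [/\ uniq s, size s = n & forall x, x \in s <-> A x].
Proof.
move=> An; have Af : finite_set A by exists n.
exists (fset_set A); split; first exact: fset_uniq.
  exact: card_fset_set.
by move=> x; split => [|Ax]; [rewrite in_fset_set// inE|rewrite in_fset_set// inE].
Qed.

Lemma sorted_row (R : realType) (k : nat) (q : seq R) : uniq q -> size q = k ->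
  exists c : 'rV[R]_k, increasing c /\ perm_eq [seq c 0 j | j <- enum 'I_k] q.
Proof.
move=> uq qk; pose s := sort <=%R q.
have sk : size s = k by rewrite size_sort.
exists (\row_j nth 0 s j); split.
  move=> i j ij; rewrite !mxE.
  have ss : sorted <%R s by rewrite sort_lt_sorted.
  by apply: (sorted_ltn_nth lt_trans 0 ss) => //; rewrite inE sk.
rewrite (_ : [seq _ | j <- _] = s) ?perm_sort//.
rewrite -[RHS](mkseq_nth 0) sk /mkseq -val_enum_ord -map_comp.
by apply: eq_map => j /=; rewrite mxE.
Qed.

Section critical_families.
Variables (R : realType) (k N : nat) (E : finType) (D : {set E}) (m : E -> 'I_k -> nat).
Hypothesis mN : {in D, forall e, (\sum_j m e j).+1 = N}.

Lemma critical_families_locally_bounded (a : Pspace R N) :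
  exists b : R, nbhs a [set a' | {in D, forall e (c : 'rV[R]_k) j, centered (m e) c ->
    critical_row N (m e) c = a' -> (0 < m e j)%N -> `|c 0 j| <= b}].
Proof.
have h e : exists b : R, e \in D -> nbhs a [set a' | forall (c : 'rV[R]_k) j,
    centered (m e) c -> critical_row N (m e) c = a' -> (0 < m e j)%N -> `|c 0 j| <= b].
  have [eD|eD] := boolP (e \in D); last by exists 0.
  by have [b ?] := critical_points_locally_bounded (mN eD) a; exists b.
have [b hb] := choice h; exists (\sum_e `|b e|).
pose P e (a' : Pspace R N) := e \in D -> forall (c : 'rV[R]_k) j,
    centered (m e) c -> critical_row N (m e) c = a' -> (0 < m e j)%N -> `|c 0 j| <= b e.
have : nbhs a [set a' | forall e, P e a'].
  apply: (@filter_forall _ _ P (nbhs a) _) => e; have [eD|neD] := boolP (e \in D); last first.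
    by apply: nearW => a' eD; rewrite eD in neD.
  by apply: filterS (hb e eD) => a' ha' _.
apply: filterS => a' ha' e eD c j cc ca mj.
apply: (le_trans (ha' e eD c j cc ca mj)); apply: (le_trans (ler_norm _)).
by rewrite (bigD1 e)//= lerDl sumr_ge0.
Qed.

Lemma horner_inj_root_val (f : {poly R}) (m0 : 'I_k -> nat) (c : 'rV[R]_k) : (0 < N)%N ->
  f^`() = N%:R *: root_prod m0 c ->
  injective (fun j => f.[c 0 j]) <-> injective (root_val m0 c).
Proof.
move=> N0 fE; have [b ->] : exists b : R, f = N%:R *: integ (root_prod m0 c) + b%:P.
  by apply: eq_deriv_cst; rewrite fE derivZ deriv_integ.
have NR0 : N%:R != 0 :> R by rewrite pnatr_eq0 -lt0n.
split=> inj i j; rewrite -/(root_val _ _ _) => ij; apply: inj.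
  by rewrite !hornerD !hornerZ !hornerC -!/(root_val _ _ _) ij.
move: ij; rewrite !hornerD !hornerZ !hornerC -!/(root_val _ _ _) => /addIr.
by move/(mulfI NR0).
Qed.

End critical_families.

(** * Morsifications as images of chambers *)

Section morsifications.
Variables (R : realType) (n l : nat).
Hypothesis n0 : (0 < n)%N.
Local Notation k := (n - 1 + l)%N.
Implicit Types (e : {ffun 'I_l -> 'I_k}) (c : 'rV[R]_k).

(* A boundary point counts as a root of multiplicity 0 of the derivative. *)
Definition morsification_mult e (j : 'I_k) : nat := (j \notin codom e).

Definition morsification e c : Pspace R n * 'rV[R]_l :=
  (critical_row n (morsification_mult e) c,
   \row_i recenter (morsification_mult e) c 0 (e i)).

(** [e i] is the rank of the boundary point labelled [i] in the increasing list of all critical and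
    boundary points. *)
Definition placements : {set {ffun 'I_l -> 'I_k}} :=
  [set e : {ffun 'I_l -> 'I_k} | injectiveb e]%SET.

Definition crit_seq e c : seq R := [seq c 0 j | j <- enum 'I_k & j \notin codom e].

Lemma root_prod_crit_seq e c :
  root_prod (morsification_mult e) c = \prod_(x <- crit_seq e c) ('X - x%:P).
Proof.
rewrite /crit_seq big_map big_filter big_enum_cond [RHS]big_mkcond.
by apply: eq_bigr => j _; rewrite /morsification_mult; case: (j \notin _).
Qed.

Lemma sum_morsification_mult : {in placements, forall e,
  (\sum_j morsification_mult e j).+1 = n}.
Proof.
move=> e; rewrite inE => /injectiveP einj.
rewrite (_ : \sum_j _ = #|[predC codom e]|)%N; last first.
  rewrite -sum1_card [RHS]big_mkcond; apply: eq_bigr => j _.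
  by rewrite inE /morsification_mult; case: (j \in _).
have : (#|codom e| + #|[predC codom e]| = #|'I_k|)%N.
  by rewrite -(cardC (mem (codom e))); congr addn; apply: eq_card.
by rewrite (card_codom einj) !card_ord; lia.
Qed.

Lemma size_crit_seq e c : e \in placements -> size (crit_seq e c) = (n - 1)%N.
Proof.
move=> eD; have := sum_morsification_mult eD.
have := size_root_prod (morsification_mult e) c.
by rewrite root_prod_crit_seq size_prod_XsubC; lia.
Qed.

Lemma crit_seq_codom_perm e : e \in placements ->
  perm_eq ([seq j <- enum 'I_k | j \notin codom e] ++ codom e) (enum 'I_k).
Proof.
rewrite inE => einj; apply: uniq_perm; rewrite ?enum_uniq//.
  rewrite cat_uniq filter_uniq ?enum_uniq//= andbC; apply/andP; split=> //.
  by apply/hasPn => j je; rewrite mem_filter je.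
by move=> j; rewrite mem_cat mem_filter mem_enum /= andbT orNb.
Qed.

Lemma uniq_values e c (f : {poly R}) : e \in placements ->
  uniq ([seq f.[x] | x <- crit_seq e c] ++ [seq f.[c 0 (e i)] | i : 'I_l]) <->
  injective (fun j => f.[c 0 j]).
Proof.
move=> eD; rewrite /crit_seq -map_comp.
rewrite (_ : [seq f.[c 0 (e i)] | i : 'I_l] = [seq f.[c 0 j] | j <- codom e]); last first.
  by rewrite -map_comp.
rewrite -map_cat (perm_uniq (perm_map _ (crit_seq_codom_perm eD))).
by split=> /injectiveP.
Qed.

Lemma morsification_placements : {in placements, forall e c, increasing c ->
  injective (root_val (morsification_mult e) c) ->
  very_nice_M_morsification (morsification e c)}.
Proof.
move=> e eD c cinc vinj; have mN := sum_morsification_mult eD.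
split; first exact: M_domain_critical_row.
exists (crit_seq e (recenter (morsification_mult e) c)); split.
- exact: size_crit_seq.
- by rewrite /= deriv_Ppoly_critical_row// root_prod_crit_seq.
- rewrite (_ : [seq _ | i : 'I_l] = [seq (Ppoly (morsification e c).1).[
      recenter (morsification_mult e) c 0 (e i)] | i : 'I_l]); last first.
    by apply: eq_map => i; rewrite mxE.
  apply/uniq_values => //; apply/(horner_inj_root_val n0 (m0 := morsification_mult e)).
    exact: deriv_Ppoly_critical_row.
  exact: recenter_val_inj.
Qed.

(** Distinct values force the critical and boundary points to be distinct, so they can be sorted
    together; [e] records where the boundary points end up. *)
Lemma morsification_cover x : very_nice_M_morsification x ->
  exists2 e, e \in placements & exists c, [/\ increasing c,
    injective (root_val (morsification_mult e) c) & morsification e c = x].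
Proof.
case: x => a b [_ [s [sn fE]]] /= us.
set f := Ppoly a in fE us.
pose q := s ++ [seq b 0 i | i : 'I_l].
have uq : uniq [seq f.[x] | x <- q] by rewrite map_cat -map_comp.
have qk : size q = k by rewrite size_cat size_map -cardE card_ord sn.
have [c [cinc cq]] := sorted_row (map_uniq uq) qk.
have /choice[p pb] : forall i, exists j, c 0 j = b 0 i.
  move=> i; have : b 0 i \in q by rewrite mem_cat orbC map_f// mem_enum.
  by rewrite -(perm_mem cq) => /mapP[j _ ->]; exists j.
pose e : {ffun 'I_l -> 'I_k} := finfun p.
have ueb : uniq [seq f.[b 0 i] | i : 'I_l] by move: us; rewrite cat_uniq => /and3P[].
have einj : injective e.
  move=> i i'; rewrite !ffunE => pp; have /injectiveP := ueb; apply.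
  by rewrite -!pb pp.
have eD : e \in placements by rewrite inE; apply/injectiveP.
have codomE j : (j \in codom e) = (c 0 j \in [seq b 0 i | i : 'I_l]).
  apply/codomP/mapP => [[i ->]|[i _]].
    by exists i; rewrite ?mem_enum// ffunE pb.
  by rewrite -pb => /(increasing_inj cinc) ->; exists i; rewrite ffunE.
have rpE : root_prod (morsification_mult e) c = \prod_(x <- s) ('X - x%:P).
  rewrite root_prod_crit_seq (_ : crit_seq e c =
      [seq x <- [seq c 0 j | j <- enum 'I_k] | x \notin [seq b 0 i | i : 'I_l]]); last first.
    rewrite filter_map /crit_seq; congr map; apply: eq_filter => j /=.
    by rewrite codomE.
  rewrite big_filter (perm_big _ cq)/= big_cat/= [X in _ * X]big1_seq ?mulr1; last first.
    by move=> x /andP[/negbTE h]; rewrite h.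
  rewrite big_seq_cond [RHS]big_seq; apply: eq_bigl => x.
  have [xs|//] := boolP (x \in s).
  move: (map_uniq uq); rewrite cat_uniq => /and3P[_ /hasPn h _] /=.
  by apply: contraTN xs => /h.
have fE' : f^`() = n%:R *: root_prod (morsification_mult e) c by rewrite rpE.
have [cc ca] := critical_rowP (sum_morsification_mult eD) fE'.
exists e => //; exists c; split=> //.
  apply/(horner_inj_root_val n0 fE'); apply/(uniq_values c f eD).
  rewrite (_ : [seq f.[c 0 (e i)] | i : 'I_l] = [seq f.[b 0 i] | i : 'I_l]); last first.
    by apply: eq_map => i; rewrite ffunE pb.
  have := prod_XsubC_eq (etrans (esym (root_prod_crit_seq e c)) rpE) => sc.
  rewrite (perm_uniq (s2 := [seq f.[x] | x <- s] ++ [seq f.[b 0 i] | i : 'I_l]))//.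
  by rewrite perm_cat2r perm_map.
rewrite /morsification ca; congr pair; apply/rowP => i.
by rewrite mxE recenter_id// ffunE pb.
Qed.

(** Unique factorisation identifies the list of critical points given by membership with
    [crit_seq e c]; the distinct values then separate all points of [c]. *)
Lemma morsification_rigid : {in placements, forall e c, weakly_increasing c ->
  centered (morsification_mult e) c -> very_nice_M_morsification (morsification e c) ->
  increasing c /\ injective (root_val (morsification_mult e) c)}.
Proof.
move=> e eD c cw cc [_ [s [_]]] /=; have mN := sum_morsification_mult eD.
set f := Ppoly _ => fE us.
have fE' : f^`() = n%:R *: root_prod (morsification_mult e) c.
  by rewrite deriv_Ppoly_critical_row// recenter_id.
have nR0 : n%:R != 0 :> R by rewrite pnatr_eq0 -lt0n.
have sc : perm_eq (crit_seq e c) s.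
  apply: prod_XsubC_eq; rewrite -root_prod_crit_seq.
  by apply: (scalerI nR0); rewrite -fE' fE.
have finj : injective (fun j => f.[c 0 j]).
  apply/(uniq_values c f eD).
  rewrite (_ : [seq f.[c 0 (e i)] | i : 'I_l] = [seq f.[(morsification e c).2 0 i] | i : 'I_l]).
    rewrite (perm_uniq (s2 := [seq f.[x] | x <- s] ++
      [seq f.[(morsification e c).2 0 i] | i : 'I_l]))//.
    by rewrite perm_cat2r perm_map.
  by apply: eq_map => i; rewrite mxE recenter_id.
split; last exact/(horner_inj_root_val n0 fE').
by apply: weakly_increasing_inj_increasing => // i j cij; apply: finj; rewrite cij.
Qed.

(** The image determines the critical points by factorisation and the boundary points as
    coordinates, hence the sorted row [c]; the positions of the labels in it give [e]. *)
Lemma morsification_inj : {in placements &, forall e e' c c',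
  increasing c -> increasing c' ->
  centered (morsification_mult e) c -> centered (morsification_mult e') c' ->
  morsification e c = morsification e' c' -> e = e' /\ c = c'}.
Proof.
move=> e e' eD e'D c c' cinc c'inc cc cc' ec.
have nR0 : n%:R != 0 :> R by rewrite pnatr_eq0 -lt0n.
have be i : c 0 (e i) = c' 0 (e' i).
  have : (morsification e c).2 0 i = (morsification e' c').2 0 i by rewrite ec.
  by rewrite [LHS]mxE [RHS]mxE !recenter_id.
have sc : perm_eq (crit_seq e c) (crit_seq e' c').
  apply: prod_XsubC_eq; rewrite -!root_prod_crit_seq; apply: (scalerI nR0).
  have := deriv_Ppoly_critical_row (sum_morsification_mult eD) c.
  have := deriv_Ppoly_critical_row (sum_morsification_mult e'D) c'.
  by rewrite !recenter_id// => <- <-; have /= -> := congr1 fst ec.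
have allE (d : 'rV[R]_k) (g : {ffun 'I_l -> 'I_k}) : g \in placements ->
    [seq d 0 j | j <- enum 'I_k] =i crit_seq g d ++ [seq d 0 (g i) | i : 'I_l].
  move=> gD x; rewrite -(perm_mem (perm_map _ (crit_seq_codom_perm gD))) map_cat.
  by rewrite !mem_cat -map_comp.
have cc'E : c = c'.
  apply: eq_increasing => // x; rewrite (allE c e)// (allE c' e')// !mem_cat (perm_mem sc).
  by congr (_ || (x \in _)); apply: eq_map => i; exact: be.
split=> //; apply/ffunP => i; apply: (increasing_inj cinc).
by rewrite be cc'E.
Qed.

(** Critical points are bounded through the coefficients, boundary points directly as coordinates of
    the second component. *)
Lemma morsification_proper (x : Pspace R n * 'rV[R]_l) :
  exists b : R, nbhs x [set y | {in placements, forall e c,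
    centered (morsification_mult e) c -> morsification e c = y -> forall j, `|c 0 j| <= b}].
Proof.
have [b1 h1] := critical_families_locally_bounded sum_morsification_mult x.1.
pose b2 := \sum_i (`|x.2 0 i| + 1).
have h2 : nbhs x.2 [set y : 'rV[R]_l | forall i, `|y 0 i| < `|x.2 0 i| + 1].
  apply: (@filter_forall _ _ (fun i (y : 'rV[R]_l) => `|y 0 i| < `|x.2 0 i| + 1)
    (nbhs x.2) _) => i.
  have hc : {for x.2, continuous (fun y : 'rV[R]_l => `|y 0 i|)}.
    apply: (@continuous_comp _ _ _ (fun y : 'rV[R]_l => y 0 i) (fun z : R => `|z|)).
      exact: coord_continuous.
    exact: norm_continuous.
  have lt1 : `|x.2 0 i| < `|x.2 0 i| + 1 by rewrite ltrDl.
  exact: (hc _ (lt_nbhsl lt1)).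
exists (Num.max b1 b2).
move: h1 h2; set X1 := (X in nbhs x.1 X); set X2 := (X in nbhs x.2 X) => h1 h2.
exists (X1, X2) => //.
move=> y [/= hy1 hy2] e eD c cc ec j.
have [|jc] := boolP (0 < morsification_mult e j)%N.
  move=> mj; rewrite le_max; apply/orP; left.
  by apply: (hy1 e eD c j cc _ mj); rewrite -ec.
rewrite le_max; apply/orP; right.
have /codomP[i ->] : j \in codom e by move: jc; rewrite lt0b negbK.
have := hy2 i; rewrite -ec mxE recenter_id// => /ltW/le_trans; apply.
by rewrite /b2 (bigD1 i)//= lerDl sumr_ge0// => i' _; rewrite addr_ge0.
Qed.

Lemma morsification_continuous e : continuous (morsification e).
Proof.
have m1 := @critical_row_continuous R k n (morsification_mult e).
have m2 : continuous (fun c => \row_i recenter (morsification_mult e) c 0 (e i) : 'rV[R]_l).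
  apply: continuous_row => i; rewrite (_ : (fun _ => _) =
    fun c => recenter (morsification_mult e) c 0 (e i)); last first.
    by apply/funext => c; rewrite mxE.
  move=> c; apply: (@continuous_comp _ _ _ (recenter (morsification_mult e))
    (fun v => v 0 (e i))).
    exact: recenter_continuous.
  exact: coord_continuous.
by move=> c; exact: cvg_pair (m1 c) (m2 c).
Qed.

Lemma morsification_components :
  finite_set (components (@very_nice_M_morsification R n l)) /\
  K R n l = #|chamber_types R placements morsification_mult|.
Proof.
apply: (chamber_decomposition (Th := morsification)).
- exact: norm_hausdorff.
- by move=> e _; exact: morsification_continuous.
- by move=> e c; rewrite /morsification critical_row_recenter
    (recenter_id (recenter_centered _ _)).
- exact: morsification_cover.
- exact: morsification_placements.
- exact: morsification_rigid.
- exact: morsification_inj.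
- exact: morsification_proper.
Qed.

End morsifications.

(** * Caustic strata as images of chambers, and comparison of the counts *)

Section strata.
Variables (R : realType) (n l : nat).
Hypothesis n0 : (0 < n)%N.
Local Notation k := (n - 1 + l)%N.
Local Notation N := (2 * l + n)%N.
Implicit Types (E : {set 'I_k}) (c : 'rV[R]_k).

Definition stratum_mult E (j : 'I_k) : nat := (j \in E).+1.

Definition double_points : {set {set 'I_k}} := [set E : {set 'I_k} | #|E| == l]%SET.

Let N0 : (0 < N)%N. Proof. lia. Qed.
Let NR0 : N%:R != 0 :> R. Proof. by rewrite pnatr_eq0 -lt0n. Qed.

Lemma sum_stratum_mult : {in double_points, forall E, (\sum_j stratum_mult E j).+1 = N}.
Proof.
move=> E; rewrite inE => /eqP El.
rewrite (eq_bigr (fun j => (j \in E) + 1)%N) => [|j _]; last by rewrite addn1.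
rewrite big_split/= sum1_card card_ord.
rewrite (_ : \sum_j _ = l)%N; first by lia.
by rewrite -[RHS]El -sum1_card [RHS]big_mkcond; apply: eq_bigr => j _; case: (j \in E).
Qed.

Lemma root_root_prod_stratum E c x :
  root (root_prod (stratum_mult E) c) x = (x \in [seq c 0 j | j <- enum 'I_k]).
Proof.
rewrite root_root_prod; apply/existsP/mapP => [[j /andP[_ /eqP ->]]|[j _ ->]].
  by exists j; rewrite ?mem_enum.
by exists j; rewrite eqxx.
Qed.

Lemma mup_scale (a : R) (p : {poly R}) x : a != 0 -> mup x (a *: p) = mup x p.
Proof.
move=> a0; rewrite -mul_polyC mulrC mupMl// rootC.
by [].
Qed.

Lemma mup_stratum E c x d : increasing c ->
  mup x (root_prod (stratum_mult E) c) = d.+1 <->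
  x \in [seq c 0 j | j <- enum 'I_k & stratum_mult E j == d.+1].
Proof.
move=> cinc; have cinj := increasing_inj cinc; split.
  move=> xd; have : root (root_prod (stratum_mult E) c) x.
    by apply: contraT => /mupNroot; rewrite xd.
  rewrite root_root_prod_stratum => /mapP[j _ xj].
  rewrite xj mup_root_prod// in xd.
  by apply/mapP; exists j => //; rewrite mem_filter mem_enum xd eqxx.
by move=> /mapP[j]; rewrite mem_filter => /andP[/eqP jd _] ->; rewrite mup_root_prod.
Qed.

Lemma card_mup_stratum E c (f : {poly R}) d : increasing c ->
  f = N%:R *: root_prod (stratum_mult E) c ->
  [set x | mup x f = d.+1] #= `I_#|[pred j | stratum_mult E j == d.+1]|.
Proof.
move=> cinc ->.
have -> : #|[pred j | stratum_mult E j == d.+1]| =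
    size [seq c 0 j | j <- enum 'I_k & stratum_mult E j == d.+1].
  rewrite size_map size_filter -sum1_count big_enum_cond /= -sum1_card.
  by apply: eq_bigl => j; rewrite inE.
apply: set_of_seq_card.
  by rewrite (map_inj_uniq (increasing_inj cinc)) filter_uniq ?enum_uniq.
by move=> x; rewrite -(mup_stratum E x d cinc) /= mup_scale.
Qed.

Lemma stratum_land : {in double_points, forall E c, increasing c ->
  injective (root_val (stratum_mult E) c) ->
  caustic_strata l (n - 1) (critical_row N (stratum_mult E) c)}.
Proof.
move=> E ED c cinc vinj; have mN := sum_stratum_mult ED.
have fE := deriv_Ppoly_critical_row mN c.
have rinc := recenter_increasing (stratum_mult E) cinc.
have El : #|E| = l by move: ED; rewrite inE => /eqP.
split; first exact: M_domain_critical_row.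
- have := card_mup_stratum 1 rinc fE; rewrite (_ : #|_| = l)//.
  rewrite -[RHS]El; apply: eq_card => j.
  by rewrite inE /stratum_mult eqSS; case: (j \in E).
- have := card_mup_stratum 0 rinc fE; rewrite (_ : #|_| = n - 1)%N//.
  have := cardsC E; rewrite El card_ord.
  rewrite (_ : #|~: E| = #|[pred j | stratum_mult E j == 1%N]|).
    by rewrite addnC => /addIn.
  by apply: eq_card => j; rewrite !inE /stratum_mult eqSS; case: (j \in E).
- move=> x y; rewrite fE !rootZ// !root_root_prod_stratum => /mapP[i _ ->] /mapP[j _ ->].
  apply: contra => /eqP ij; apply/eqP; congr (recenter _ _ 0 _).
  have /(horner_inj_root_val N0 fE) := @recenter_val_inj _ _ _ (stratum_mult E) _ vinj.
  exact.
Qed.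

Lemma caustic_roots (a : Pspace R N) : caustic_strata l (n - 1) a ->
  exists s : seq R * seq R, [/\ uniq (s.1 ++ s.2), size s.1 = l, size s.2 = (n - 1)%N,
    forall x, x \in s.1 <-> mup x (Ppoly a)^`() = 2%N
  & forall x, x \in s.2 <-> mup x (Ppoly a)^`() = 1%N].
Proof.
move=> [_ /seq_of_card[s2 [us2 ss2 s2E]] /seq_of_card[s1 [us1 ss1 s1E]] _].
exists (s2, s1); split => //=.
rewrite cat_uniq us2 us1 andbT; apply/hasPn => x /s1E /= x1.
by apply/negP => /s2E /=; rewrite x1.
Qed.

(** The [l] double and [n - 1] simple roots account for [2 * l + n - 1], the full degree of the
    derivative; their product divides it, so the two agree up to the factor [N]. *)
Lemma stratum_cover (a : Pspace R N) : caustic_strata l (n - 1) a ->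
  exists2 E, E \in double_points & exists c, [/\ increasing c,
    injective (root_val (stratum_mult E) c) & critical_row N (stratum_mult E) c = a].
Proof.
move=> aA; have [[s2 s1] /= [us ss2 ss1 s2E s1E]] := caustic_roots aA.
have [_ _ _ fneq] := aA; set f := Ppoly a in fneq s2E s1E.
have qk : size (s2 ++ s1) = k by rewrite size_cat ss2 ss1 addnC.
have [c [cinc cq]] := sorted_row us qk; have cinj := increasing_inj cinc.
pose E : {set 'I_k} := [set j | c 0 j \in s2]%SET.
have ED : E \in double_points.
  rewrite inE; apply/eqP; rewrite -[RHS]ss2 cardE -(size_map (c 0)).
  apply/perm_size/uniq_perm.
  - by rewrite map_inj_uniq ?enum_uniq.
  - by move: us; rewrite cat_uniq => /and3P[].
  move=> x; apply/mapP/idP => [[j]|xs]; first by rewrite mem_enum inE => + ->.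
  have : x \in s2 ++ s1 by rewrite mem_cat xs.
  rewrite -(perm_mem cq) => /mapP[j _ xj].
  by exists j => //; rewrite mem_enum inE -xj.
have mupE j : mup (c 0 j) f^`() = stratum_mult E j.
  have : c 0 j \in s2 ++ s1 by rewrite -(perm_mem cq) map_f// mem_enum.
  rewrite mem_cat /stratum_mult inE; have [/s2E -> //|_ /=] := boolP (c 0 j \in s2).
  by move=> /s1E.
have fN : f^`()`_N.-1 = N%:R.
  by rewrite coef_deriv prednK// coef_Ppoly_out ?eqxx ?ltn_subrL ?N0 ?orbT.
have szf : size f^`() = N.
  apply/eqP; rewrite eqn_leq; apply/andP; split.
    apply/leq_sizeP => i Ni; rewrite coef_deriv coef_Ppoly_out; last by lia.
    by rewrite gtn_eqF ?mul0rn.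
  rewrite -(prednK N0) ltnNge; apply/negP => sz.
  by move: fN; rewrite nth_default// => /esym/eqP; rewrite (negbTE NR0).
have f0 : f^`() != 0 by rewrite -size_poly_eq0 szf -lt0n.
have fE : f^`() = N%:R *: root_prod (stratum_mult E) c.
  have dv : root_prod (stratum_mult E) c %| f^`().
    by apply: root_prod_dvd => // j; rewrite -mup_geq// mupE.
  have : root_prod (stratum_mult E) c %= N%:R^-1 *: f^`().
    rewrite eqp_sym; apply: (eqp_trans (eqp_scale _ _)); first by rewrite invr_neq0.
    by rewrite eqp_sym -dvdp_size_eqp// szf size_root_prod sum_stratum_mult.
  rewrite eqp_monic ?monic_root_prod//; last first.
    by rewrite monicE lead_coefZ lead_coefE szf fN mulVf.
  by move=> /eqP ->; rewrite scalerA divff// scale1r.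
have [cc ca] := critical_rowP (sum_stratum_mult ED) fE.
exists E => //; exists c; split=> //.
apply/(horner_inj_root_val N0 fE) => i j fij; apply/eqP; apply: contraT => ij.
have := fneq (c 0 i) (c 0 j); rewrite fE !rootZ// !root_root_prod_stratum.
rewrite !map_f ?mem_enum// => /(_ isT isT); rewrite (inj_eq cinj) ij => /(_ isT).
by rewrite fij eqxx.
Qed.

(** In the stratum the derivative has [l + (n - 1)] distinct roots, as many as [c] has entries, and
    all of them occur in [c]; so no two entries coincide. *)
Lemma stratum_rigid : {in double_points, forall E c, weakly_increasing c ->
  centered (stratum_mult E) c ->
  caustic_strata l (n - 1) (critical_row N (stratum_mult E) c) ->
  increasing c /\ injective (root_val (stratum_mult E) c)}.
Proof.
move=> E ED c cw cc aA; have [[s2 s1] /= [us ss2 ss1 s2E s1E]] := caustic_roots aA.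
have [_ _ _ fneq] := aA; set f := Ppoly _ in fneq s2E s1E.
have fE : f^`() = N%:R *: root_prod (stratum_mult E) c.
  by rewrite /f deriv_Ppoly_critical_row ?recenter_id// sum_stratum_mult.
have uc : uniq [seq c 0 j | j <- enum 'I_k].
  apply: (leq_size_uniq us).
    move=> x xs; rewrite -(root_root_prod_stratum E) -(rootZ _ _ NR0) -fE.
    apply: contraT => /mupNroot fx; move: xs; rewrite mem_cat.
    by case/orP=> [/s2E|/s1E]; rewrite fx.
  by rewrite size_map size_cat ss2 ss1 size_enum_ord addnC.
have cinj : injective (c 0) by apply/injectiveP.
split; first exact: weakly_increasing_inj_increasing.
apply/(horner_inj_root_val N0 fE) => i j fij; apply/eqP; apply: contraT => ij.
have := fneq (c 0 i) (c 0 j); rewrite fE !rootZ// !root_root_prod_stratum.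
rewrite !map_f ?mem_enum// => /(_ isT isT); rewrite (inj_eq cinj) ij => /(_ isT).
by rewrite fij eqxx.
Qed.

(** The roots of the derivative determine the sorted row [c], and their multiplicities determine
    [E]. *)
Lemma stratum_inj : {in double_points &, forall E E' c c',
  increasing c -> increasing c' -> centered (stratum_mult E) c ->
  centered (stratum_mult E') c' ->
  critical_row N (stratum_mult E) c = critical_row N (stratum_mult E') c' ->
  E = E' /\ c = c'}.
Proof.
move=> E E' ED E'D c c' cinc c'inc cc cc' ec.
have pE : root_prod (stratum_mult E) c = root_prod (stratum_mult E') c'.
  apply: (scalerI NR0).
  have := deriv_Ppoly_critical_row (sum_stratum_mult ED) c.
  have := deriv_Ppoly_critical_row (sum_stratum_mult E'D) c'.
  by rewrite !recenter_id// => <- <-; rewrite ec.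
have cc'E : c = c'.
  by apply: eq_increasing => // x; rewrite -(root_root_prod_stratum E) pE
    root_root_prod_stratum.
split=> //; apply/setP => j.
have := mup_root_prod (stratum_mult E) j (increasing_inj cinc).
rewrite pE cc'E mup_root_prod; last exact: increasing_inj.
by rewrite /stratum_mult; case: (j \in E); case: (j \in E').
Qed.

Lemma stratum_components :
  finite_set (components (@caustic_strata R N l (n - 1))) /\
  nb_components (@caustic_strata R N l (n - 1)) =
    #|chamber_types R double_points stratum_mult|.
Proof.
apply: (chamber_decomposition (Th := fun E => critical_row N (stratum_mult E))).
- exact: norm_hausdorff.
- by move=> E _; exact: critical_row_continuous.
- by move=> E c; rewrite critical_row_recenter.
- exact: stratum_cover.
- exact: stratum_land.
- exact: stratum_rigid.
- exact: stratum_inj.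
- move=> a; have [b hb] := critical_families_locally_bounded sum_stratum_mult a.
  exists b; apply: filterS hb => a' ha' E ED c cc ca j.
  exact: (ha' E ED c j cc ca).
Qed.

(* Changing multiplicities 0, 1 into 2, 1 does not change their parities. *)
Lemma card_chamber_types :
  #|chamber_types R (@placements n l) (@morsification_mult n l)| =
  (l`! * #|chamber_types R double_points stratum_mult|)%N.
Proof.
set X := chamber_types _ _ _; set Y := chamber_types _ _ _.
pose supp (e : {ffun 'I_l -> 'I_k}) : {set 'I_k} := [set j in codom e]%SET.
pose h (x : {ffun 'I_l -> 'I_k} * {ffun 'I_k * 'I_k -> bool}) := (supp x.1, x.2).
have rE e o : realizable R (morsification_mult e) o <->
    realizable R (stratum_mult (supp e)) o.
  by split; apply: eq_realizable => j;
    rewrite /morsification_mult /stratum_mult inE; case: (j \in _).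
have suppE e : e \in placements n l -> #|supp e| = l.
  by rewrite inE => /injectiveP einj; rewrite cardsE card_codom// card_ord.
have hXY x : x \in X -> h x \in Y.
  rewrite !inE => /andP[/= eD /asboolP ro].
  rewrite suppE ?inE// eqxx; apply/asboolP/rE; exact: ro.
(* [h] forgets the labels of the boundary points; it remains to see that each of its fibres has [l!]
   elements. *)
rewrite -sum1_card (partition_big h (mem Y))//= mulnC -sum_nat_const.
apply: eq_bigr => -[E o] EoY; rewrite sum1_card.
have El : #|E| = l by move: EoY; rewrite !inE => /andP[/eqP].
have Er : realizable R (stratum_mult E) o.
  by move: EoY; rewrite inE => /andP[_ /asboolP].
(* The fibre over [(E, o)] consists of the injections from ['I_l] into [E], which are bijections
   because [#|E| = l]. *)
pose S := [set f : {ffun 'I_l -> 'I_k} in ffun_on (mem E) | injectiveb f]%SET.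
have cS : #|S| = l`! by rewrite card_inj_ffuns_on card_ord El ffactnn.
rewrite -cS -(card_imset S (_ : injective (fun e => (e, o)))); last by move=> ? ? [].
apply: eq_card => -[e o']; rewrite [LHS]unfold_in inE /= inE; apply/idP/imsetP.
  move=> /andP[/andP[einj _] /eqP[sE <-]]; exists e => //; rewrite inE einj andbT.
  by apply/ffun_onP => i; rewrite -sE inE codom_f.
move=> [f]; rewrite inE => /andP[/ffun_onP fE finj] [-> ->].
have sE : supp f = E.
  apply/eqP; rewrite eqEcard El suppE ?inE// leqnn andbT.
  by apply/fintype.subsetP => j; rewrite inE => /codomP[i ->]; exact: fE.
by rewrite finj /h /= sE eqxx andbT; apply/asboolP/rE; rewrite sE.
Qed.

End strata.

Theorem corollary3p4 (R : realType) (n l : nat) (hn : (1 <= n)%N) :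
  finite_set (components (@very_nice_M_morsification R n l)) /\
  finite_set (components (@caustic_strata R (2 * l + n) l (n - 1))) /\
  (nb_components (@caustic_strata R (2 * l + n) l (n - 1)))%:R
    = (K R n l)%:R / l`!%:R :> rat.
Proof.
have [Xfin KE] := morsification_components R l hn.
have [Yfin YE] := stratum_components R l hn.
split=> //; split=> //; rewrite KE YE card_chamber_types// natrM mulrC mulKf//.
by rewrite pnatr_eq0 -lt0n fact_gt0.
Qed.
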